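(* Let $f:I\to I$ be a piecewise monotonic smooth expanding interval map which has a unique absolutely continuous invariant probability measure $\mu$ and is mixing with respect to $\mu$. Then the mixing rate $\alpha_{BV}$ for the space of functions of bounded variation on $I$ satisfies $$\alpha_{BV}\le\Lambda ,$$ where $\Lambda=\int_I\ln|f'(x)|\,d\mu(x)$ is the Lyapunov exponent of $f$ with respect to $\mu$.
   Context: $I$ is a compact interval of positive length. A map $f:I\to I$ is called piecewise monotonic, smooth and expanding if there is a finite collection of closed intervals $I_1,\dots,I_N$ of positive length with pairwise disjoint interiors and union $I$ such that, for each $k$, $f$ restricted to $\mathrm{int}(I_k)$ is strictly monotone and extends to a $C^\infty$ function on $I_k$, and $\inf\{|f'(x)|: x\in\bigcup_k\mathrm{int}(I_k)\}>1$. Absolute continuity is with respect to Lebesgue measure. A function $h:I\to\mathbb{R}$ is of bounded variation if $\mathrm{var}(h)=\sup\{\sum_{i=1}^p|h(x_i)-h(x_{i-1})| : p\ge 1,\ x_0\le x_1\le\dots\le x_p,\ x_i\in I\}<\infty$; $BV$ denotes the linear space of such functions. For observables $\varphi,\psi$ and $n\ge0$ put $$C_{\varphi,\psi}(n)=\int_I \varphi(f^n(x))\psi(x)\,d\mu-\int_I\varphi\,d\mu\int_I\psi\,d\mu ,$$ $$\alpha_{\varphi,\psi}=\sup\{s : \limsup_{n\to\infty}|\exp(sn)\,C_{\varphi,\psi}(n)|<\infty\}.$$ The mixing rate for $BV$ is $\alpha_{BV}=\inf\{\alpha_{\varphi,\psi}:\varphi,\psi\in BV\}$. *)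

(* Defs.v *)
From HB Require Import structures.
From mathcomp Require Import all_boot all_order all_algebra.
From mathcomp Require Import all_classical all_reals all_analysis.

Set Implicit Arguments.
Unset Strict Implicit.
Unset Printing Implicit Defensive.

Import Order.TTheory GRing.Theory Num.Theory.
Import numFieldNormedType.Exports.

Local Open Scope ring_scope.
Local Open Scope classical_set_scope.

(* The interval I is `[a, b]. A self-map of I is a total function f : R -> R
   that sends I into I, observables are total functions R -> R, and a Borel
   probability measure on I is a Borel probability measure m on R with
   m I = 1. Values outside I are irrelevant (they can only affect the junk value
   of f^`() at a and b, which m does not see when it is absolutely continuous). *)

(* g is C^oo on the interval A, with derivatives taken relative to A
   (one-sided at an endpoint of A): G n is the n-th derivative of g. *)
Definition smooth_on (R : realType) (A : set R) (g : R -> R) : Prop :=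
  exists G : nat -> R -> R,
    (forall x, A x -> G 0%N x = g x) /\
    (forall n x, A x ->
      (G n y - G n x) / (y - x) @[y --> within A x^'] --> G n.+1 x).

Definition strictly_monotone_on (R : realType) (A : set R) (f : R -> R) : Prop :=
  (forall x y, A x -> A y -> x < y -> f x < f y) \/
  (forall x y, A x -> A y -> x < y -> f y < f x).

(* The k-th closed interval is `[c k, d k], with interior `]c k, d k[. The
   derivative is the two-sided one, taken at interior points only. *)
Definition piecewise_monotonic_smooth_expanding (R : realType) (a b : R)
    (f : R -> R) : Prop :=
  exists (N : nat) (c d : 'I_N -> R),
    [/\ forall k, c k < d k,
        trivIset setT (fun k => `]c k, d k[),
        \bigcup_(k in [set: 'I_N]) `[c k, d k] = `[a, b],
        forall k, strictly_monotone_on `]c k, d k[ f /\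
          exists g : R -> R, (forall x, `]c k, d k[ x -> g x = f x) /\
                             smooth_on `[c k, d k] g
      & 1 < inf [set `|f^`() x| |
                 x in \bigcup_(k in [set: 'I_N]) `]c k, d k[]].

Definition acip (R : realType) (a b : R) (f : R -> R)
    (m : probability (measurableTypeR R) R) : Prop :=
  [/\ m `[a, b] = 1%E,
      m `<< lebesgue_measure
    & forall A : set (measurableTypeR R), measurable A ->
        m (`[a, b] `&` f @^-1` A) = m A].

(* Uniqueness is as a Borel measure: m and m' are total functions on sets,
   meaningful on measurable sets only. *)
Definition unique_acip (R : realType) (a b : R) (f : R -> R)
    (m : probability (measurableTypeR R) R) : Prop :=
  acip a b f m /\
  forall m' : probability (measurableTypeR R) R, acip a b f m' ->
    forall A : set (measurableTypeR R), measurable A -> m' A = m A.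

Definition mixing (R : realType) (a b : R) (f : R -> R)
    (m : probability (measurableTypeR R) R) : Prop :=
  forall A B : set (measurableTypeR R), measurable A -> measurable B ->
    A `<=` `[a, b] -> B `<=` `[a, b] ->
    m (`[a, b] `&` (iter n f @^-1` A) `&` B) @[n --> \oo] --> (m A * m B)%E.

Definition correlation (R : realType) (a b : R) (f : R -> R)
    (m : probability (measurableTypeR R) R) (phi psi : R -> R) (n : nat) : R :=
  \int[m]_(x in `[a, b]) (phi (iter n f x) * psi x) -
  (\int[m]_(x in `[a, b]) phi x) * (\int[m]_(x in `[a, b]) psi x).

(* Suprema and infima of rates are taken in the extended reals: the rate is
   +oo when the correlations decay superexponentially. *)
Definition correlation_rate (R : realType) (a b : R) (f : R -> R)
    (m : probability (measurableTypeR R) R) (phi psi : R -> R) : \bar R :=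
  ereal_sup [set s%:E | s in [set s : R |
    (limn_esup (fun n => `|expR (s * n%:R) * correlation a b f m phi psi n|%:E)
      < +oo)%E]].

Definition mixing_rate_BV (R : realType) (a b : R) (f : R -> R)
    (m : probability (measurableTypeR R) R) : \bar R :=
  ereal_inf [set correlation_rate a b f m phi psi |
             phi in bounded_variation a b & psi in bounded_variation a b].

Definition lyapunov_exponent (R : realType) (a b : R) (f : R -> R)
    (m : probability (measurableTypeR R) R) : \bar R :=
  (\int[m]_(x in `[a, b]) (ln `|f^`()%classic x|)%:E)%E.

(* Main.v *)
Require Import Defs.
From HB Require Import structures.
From mathcomp Require Import all_boot all_order all_algebra.
From mathcomp Require Import all_classical all_reals all_analysis.
From mathcomp Require Import measurable_realfun.
From mathcomp Require Import ring lra.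
Set Implicit Arguments.
Unset Strict Implicit.
Unset Printing Implicit Defensive.
Import Order.TTheory GRing.Theory Num.Theory.
Import numFieldNormedType.Exports.
Local Open Scope ring_scope.
Local Open Scope classical_set_scope.

(** Fix s1 > Lambda. The observable phi is the indicator of a half-line J with
    0 < theta = mu J < 1, and the correlation of phi with psi at time n is the
    integral of g_n psi, where g_n = 1_J o f^n - theta. If f^n maps an interval
    Q into J, or outside J, then g_n is a nonzero constant on Q and the integral
    of g_n over Q is comparable with mu Q. So correlations with indicators of
    intervals can only be small if such Q have small mass.

    They cannot all have small mass, because few of them carry a fixed
    proportion of mu. By invariance, the mean of the Birkhoff sum of ln |f'| over
    n steps is n Lambda, and ln |f'| >= 0, so Markov's inequality already gives a
    set of points, of mass at least some delta > 0 independent of n, where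
    |(f^n)'| <= exp(s' n) with s' slightly above Lambda. Cut the interval into
    about exp(s' n) / eta intervals of length eta exp(- s' n). Along the orbit of
    a typical point the image of such an interval stays shorter than eta, since
    |f'| varies by a factor at most exp(eps) at scale eta inside a branch; the
    room for this factor is in s'. The image is cut by an end of a branch only
    when the whole of it lies within eta of that end; this happens rarely, the
    eta-neighbourhood of the ends having small mass, and Markov's inequality
    applied to a combined weight bounds the number of such visits as well. Hence
    the typical points are covered by about exp(s1 n) intervals on which f^n is
    monotone (pieces_mass), each of which splits into at most two intervals that
    f^n maps into J or outside J (interval_mass). One of these has mass at least
    a constant times exp(- s1 n), so for every n the functional
    psi |-> int g_n psi takes a value of that order on the indicator of some
    half-line (orbit_estimate).

    It remains to find a single psi that works for infinitely many n. This
    is a uniform boundedness argument (resonance): psi is a sum of terms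
    +- 3^-p 1_(L_p), where L_p is a nearly optimal half-line for a rapidly growing
    time n_p and the signs are chosen one after the other so that the terms
    up to p cannot cancel at time n_p. It is the difference of two monotone
    functions, hence of bounded variation, and its correlations with phi are not
    O(exp(- s n)), where s > s1 is prescribed. *)

(** * Distortion on a branch *)

(** At an interior point the difference quotients relative to the segment are
    the ordinary ones. *)
Lemma is_derive_interior (R : realType) (c d : R) (G : R -> R) (x l : R) :
  c < x -> x < d ->
  (G y - G x) / (y - x) @[y --> within `[c, d] x^'] --> l -> is_derive x 1 G l.
Proof.
move=> cx xd Gl; apply/is_derive1_caratheodory.
exists (fun z => if z == x then l else (G z - G x) / (z - x)); split.
- move=> z; case: eqVneq => [->|zx]; first by rewrite !subrr mulr0.
  by rewrite divfK// subr_eq0.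
- apply/continuous_withinNx; rewrite eqxx.
  apply/cvgrPdist_lt => e e0; move/cvgrPdist_lt : Gl => /(_ e e0) Gl.
  have cdx : \forall y \near x^', c <= y <= d.
    apply: nbhs_dnbhs; have : \forall y \near x, `]c, d[%classic y.
      by apply: open_nbhs_nbhs; split; [exact: itv_open|rewrite /= in_itv/= cx].
    by apply: filterS => y; rewrite /= in_itv/= => /andP[/ltW -> /ltW ->].
  near=> y; have yx : y != x by near: y; exact: nbhs_dnbhs_neq.
  rewrite (negbTE yx); have cdy : c <= y <= d by near: y.
  suff : `[c, d]%classic y -> `|l - (G y - G x) / (y - x)| < e.
    by apply; rewrite /= in_itv.
  by near: y.
- by rewrite eqxx.
Unshelve. all: by end_near. Qed.

Lemma continuous_within_segment (R : realType) (c d : R) (G G' : R -> R) :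
  (forall x, `[c, d]%classic x ->
    (G y - G x) / (y - x) @[y --> within `[c, d] x^'] --> G' x) ->
  {within `[c, d], continuous G}.
Proof.
move=> Gl; apply/subspace_continuousP => x cdx.
apply/cvgrPdist_lt => e e0; move/cvgrPdist_lt : (Gl x cdx) => /(_ 1 ltr01).
rewrite !near_withinE => G1.
pose M := `|G' x| + 1.
have M0 : 0 < M by rewrite ltr_wpDl.
have : \forall y \near x, y != x -> `[c, d]%classic y ->
    `|G' x - (G y - G x) / (y - x)| < 1.
  by exact: G1.
move=> G2; near=> y => cdy.
have [->|yx] := eqVneq y x; first by rewrite subrr normr0.
have yx0 : 0 < `|y - x| by rewrite normr_gt0 subr_eq0.
have /(_ yx cdy) : y != x -> `[c, d]%classic y ->
    `|G' x - (G y - G x) / (y - x)| < 1 by near: y.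
rewrite distrC => /(le_lt_trans (lerB_dist _ _)).
rewrite ltrBlDr normrM normfV [_ + `|_|]addrC -/M ltr_pdivrMr// => GM.
have /(lt_trans GM) : M * `|y - x| < e.
  rewrite -ltr_pdivlMl// distrC; near: y.
  by apply: cvgr_dist_lt; [exact: cvg_id|rewrite mulr_gt0// invr_gt0].
by rewrite distrC.
Unshelve. all: by end_near. Qed.

Lemma mean_value_itvoo (R : realType) (c d : R) (f df : R -> R) :
  (forall x, `]c, d[%classic x -> is_derive x 1 f (df x)) ->
  forall x y, `]c, d[%classic x -> `]c, d[%classic y -> exists2 z,
    (x <= z <= y) || (y <= z <= x) & `|f x - f y| = `|df z| * `|x - y|.
Proof.
move=> fdf; have mvt u v : `]c, d[%classic u -> `]c, d[%classic v -> u <= v ->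
    exists2 z, u <= z <= v & f v - f u = df z * (v - u).
  rewrite /= !in_itv/= => /andP[cu ud] /andP[cv vd] uv.
  have duv w : u <= w -> w <= v -> is_derive w 1 f (df w).
    move=> uw wv; apply: fdf; rewrite /= in_itv/=.
    by rewrite (lt_le_trans cu uw) (le_lt_trans wv vd).
  have cf : {within `[u, v], continuous f}.
    apply: derivable_within_continuous => w; rewrite in_itv/= => /andP[uw wv].
    by have [] := duv w uw wv.
  have df' w : w \in `]u, v[%R -> is_derive w 1 f (df w).
    by rewrite in_itv/= => /andP[/ltW uw /ltW wv]; exact: duv.
  have [z zuv fuv] := MVT_segment uv df' cf.
  by exists z; [move: zuv; rewrite in_itv|].
move=> x y cdx cdy; have [xy|/ltW yx] := leP x y.
  have [z xzy fxy] := mvt x y cdx cdy xy; exists z; first by rewrite xzy.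
  by rewrite distrC fxy normrM [`|y - x|]distrC.
have [z xzy fxy] := mvt y x cdy cdx yx; exists z; first by rewrite xzy orbT.
by rewrite fxy normrM.
Qed.

(** The second derivative of the smooth extension is continuous on the closed
    interval, hence bounded, which
    gives one modulus of continuity for f' up to the ends of the branch. *)
Lemma smooth_on_lipschitz_derive1 (R : realType) (c d : R) (f g : R -> R) :
  c < d -> (forall x, `]c, d[%classic x -> g x = f x) -> smooth_on `[c, d] g ->
  exists B, forall x, `]c, d[%classic x -> derivable f x 1 /\
    forall y, `]c, d[%classic y -> `|derive1 f x - derive1 f y| <= B * `|x - y|.
Proof.
move=> cd gf [G [G0 GS]].
have sub x : `]c, d[%classic x -> `[c, d]%classic x.
  by rewrite /= !in_itv/= => /andP[/ltW -> /ltW ->].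
have Gd n x : `]c, d[%classic x -> is_derive x 1 (G n) (G n.+1 x).
  move=> cdx; have := cdx; rewrite /= in_itv/= => /andP[cx xd].
  exact: is_derive_interior cx xd (GS n x (sub _ cdx)).
have nearcd x : `]c, d[%classic x -> \forall y \near x, `]c, d[%classic y.
  move=> cdx; apply: open_nbhs_nbhs; split => //; exact: itv_open.
have fd x : `]c, d[%classic x -> is_derive x 1 f (G 1%N x).
  move=> cdx; apply: (@near_eq_is_derive _ _ _ (G 0%N)); last exact: Gd.
  have := nearcd _ cdx; apply: filterS => y cdy.
  by rewrite G0 ?gf//; exact: sub.
have f1 x : `]c, d[%classic x -> derive1 f x = G 1%N x.
  by move=> /fd fG; rewrite derive1E derive_val.
have c2 : {within `[c, d], continuous (fun x => `|G 2%N x|)}.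
  move=> x; apply: continuous_comp; last exact: norm_continuous.
  by apply: (@continuous_within_segment _ c d (G 2%N) (G 3%N)) => y /GS.
have [z zcd zmax] := EVT_max (ltW cd) c2.
exists `|G 2%N z| => x cdx; split; first by have [] := fd _ cdx.
move=> y cdy; rewrite !f1//.
have [w wxy ->] := mean_value_itvoo (Gd 1%N) cdx cdy.
rewrite ler_wpM2r//; apply: zmax.
move: cdx cdy wxy; rewrite /= !in_itv/= => /andP[cx xd] /andP[cy yd].
by case/orP => /andP[uw wv]; rewrite ?(le_trans (ltW cx) uw)
  ?(le_trans (ltW cy) uw) ?(le_trans wv (ltW xd)) ?(le_trans wv (ltW yd)).
Qed.

(** * Sums of monotone steps with chosen signs *)

(** Half-lines, closed or open, bounded or not, in a form that needs no case
    analysis. Their indicators are monotone, hence measurable and of bounded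
    variation, and the indicator of any interval is a difference of two of them. *)
Definition upper_set (R : realType) (L : set R) :=
  forall x y, L x -> x <= y -> L y.

Lemma upper_set_measurable (R : realType) (L : set R) :
  upper_set L -> measurable (L : set (measurableTypeR R)).
Proof.
move=> uL; apply: is_interval_measurable => x y Lx _ z /andP[xz _].
exact: uL Lx xz.
Qed.

Lemma upper_indic_nondecreasing (R : realType) (L : set R) :
  upper_set L -> {homo (\1_L : R -> R) : x y / x <= y}.
Proof.
move=> uL x y xy; rewrite !indicE ler_nat.
have [Lx|] := boolP (x \in L); last by [].
by rewrite (_ : y \in L)// inE; apply: uL xy; rewrite -[L x]inE.
Qed.

Lemma sum_third (R : realType) (p k : nat) :
  \sum_(p <= j < p + k) 3^-1 ^+ j
    = 3 / 2 * (3^-1 ^+ p - 3^-1 ^+ (p + k)) :> R.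
Proof.
elim: k => [|k IH]; first by rewrite addn0 big_geq// subrr mulr0.
by rewrite addnS big_nat_recr ?leq_addr//= IH [_ ^+ (p + k).+1]exprS; field.
Qed.

Lemma third_series (R : realType) (u : nat -> R) :
  (forall j, `|u j| <= 3^-1 ^+ j) -> exists2 l,
  \sum_(j < n) u j @[n --> \oo] --> l &
  forall N, `|l - \sum_(j < N) u j| <= 3 / 2 * 3^-1 ^+ N.
Proof.
move=> u3.
have cu : cvgn (series u).
  apply: normed_cvg; apply: (@series_le_cvg _ _ (geometric 1 3^-1)) => [n|n|n|].
  - exact: normr_ge0.
  - by rewrite /= mul1r exprn_ge0// invr_ge0.
  - by rewrite /= mul1r.
  - apply: is_cvg_geometric_series.
    by rewrite ger0_norm ?invr_ge0// invf_lt1// ltr1n.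
have su : series u = fun n => \sum_(j < n) u j.
  by apply/funext => n; rewrite seriesEord.
exists (limn (series u)); first by rewrite -su.
move=> N.
have cN : `|\sum_(j < n) u j - \sum_(j < N) u j| @[n --> \oo] -->
    `|limn (series u) - \sum_(j < N) u j|.
  by apply: cvg_norm; apply: cvgB; [rewrite -su|exact: cvg_cst].
rewrite -(cvg_lim _ cN)//; apply: limr_le; first by apply/cvg_ex; eexists; exact: cN.
near=> n; have Nn : (N <= n)%N by near: n; exact: nbhs_infty_ge.
rewrite -!(big_mkord xpredT) (big_cat_nat (leq0n N) Nn)/= addrAC subrr add0r.
apply: le_trans (ler_norm_sum _ _ _) _.
apply: le_trans (ler_sum _ (fun j _ => u3 j)) _.
rewrite -(subnKC Nn) sum_third ler_pM2l// lerBlDr lerDl exprn_ge0//.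
Unshelve. all: by end_near. Qed.

(** The limit is a function and not just a sequence of partial sums because the
    series converges uniformly, with an explicit tail. *)
Lemma staircase (R : realType) (c : nat -> R) (L : nat -> set R) :
  (forall j, 0 <= c j <= 3^-1 ^+ j) -> (forall j, upper_set (L j)) ->
  exists2 psi : R -> R, {homo psi : x y / x <= y} & forall N x,
    `|psi x - \sum_(j < N) c j * \1_(L j) x| <= 3 / 2 * 3^-1 ^+ N.
Proof.
move=> c3 uL.
have ux x : exists l, (\sum_(j < n) c j * \1_(L j) x @[n --> \oo] --> l) /\
    forall N, `|l - \sum_(j < N) c j * \1_(L j) x| <= 3 / 2 * 3^-1 ^+ N.
  have [j|l l1 l2] := @third_series _ (fun j => c j * \1_(L j) x); last by exists l.
  have /andP[c0 cj] := c3 j.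
  rewrite normrM ger0_norm// (le_trans _ cj)// ler_piMr// indicE.
  by case: (_ \in _); rewrite ?normr1 ?normr0.
have [psi psiE] := choice ux; exists psi; last by move=> N x; apply: (psiE x).2.
move=> x y xy; rewrite -(cvg_lim _ (psiE x).1)// -(cvg_lim _ (psiE y).1)//.
apply: ler_lim; [by apply/cvg_ex; eexists; exact: (psiE x).1|
  by apply/cvg_ex; eexists; exact: (psiE y).1|].
near=> n; apply: ler_sum => j _; have /andP[c0 _] := c3 j.
by rewrite ler_wpM2l// upper_indic_nondecreasing.
Unshelve. all: by end_near. Qed.

(** For real x and y one of x + y and x - y has absolute value at least |y|: the
    sign of the p-th term is chosen so that, at the index m p, it does not
    cancel against the terms before it. *)
Lemma sign_choice (R : realType) (w : nat -> nat -> R) (m : nat -> nat) :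
  exists sigma : nat -> bool, forall p, `|w p (m p)| <=
    `|\sum_(j < p.+1) (-1) ^+ sigma j * w j (m p)|.
Proof.
pose S := fix S p : nat -> R := if p is q.+1 then
  fun n => S q n + (-1) ^+ (S q (m q) * w q (m q) < 0)%R * w q n else fun=> 0.
exists (fun p => S p (m p) * w p (m p) < 0).
have SE p n : \sum_(j < p) (-1) ^+ (S j (m j) * w j (m j) < 0)%R * w j n = S p n.
  by elim: p => [|p IH]; rewrite ?big_ord0// big_ord_recr/= IH.
move=> p; rewrite SE /=; set x := S p _; set y := w p _.
have [xy|xy] := ltP (x * y) 0.
- rewrite expr1 mulN1r; have [x0|x0] := ltP x 0.
    have y0 : 0 < y by nra.
    by rewrite (gtr0_norm y0) ltr0_norm; lra.
  have y0 : y < 0 by nra.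
  by rewrite (ltr0_norm y0) ger0_norm; lra.
- rewrite expr0 mul1r; have [x0|x0|->] := ltgtP x 0; last by rewrite add0r.
    have y0 : y <= 0 by nra.
    by rewrite (ler0_norm y0) ler0_norm; lra.
  have y0 : 0 <= y by nra.
  by rewrite (ger0_norm y0) ger0_norm; lra.
Qed.

(** * Uniform boundedness in BV *)

Lemma bounded_integrable (R : realType)
    (mu : probability (measurableTypeR R) R) (h : R -> R) (M : R) :
  measurable_fun setT h -> (forall x, `|h x| <= M) ->
  mu.-integrable setT (EFin \o h).
Proof.
move=> mh hM; apply: measurable_bounded_integrable => //.
  by have /= -> := probability_setT mu; rewrite ltry.
by exists M; split; [exact: num_real|move=> y My x _; exact: le_trans (ltW My)].
Qed.

(** The total mass is 1, so that integration is a contraction for the sup norm. *)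
Lemma Rintegral_norm_le (R : realType)
    (mu : probability (measurableTypeR R) R) (h : R -> R) (M : R) :
  measurable_fun setT h -> (forall x, `|h x| <= M) ->
  `|\int[mu]_x h x| <= M.
Proof.
move=> mh hM; have ih := bounded_integrable mu mh hM.
apply: le_trans (le_normr_Rintegral _ ih) _ => //.
have <- : \int[mu]_(_ in setT) M = M.
  by rewrite Rintegral_cst//; have /= -> := probability_setT mu; rewrite mulr1.
apply: le_Rintegral => //; last first.
  apply: (@bounded_integrable _ _ _ `|M|) => //; exact: measurable_cst.
apply: (@bounded_integrable _ _ _ M) => [|x]; last by rewrite normr_id.
exact: measurableT_comp.
Qed.

Lemma measurable_indic_upper (R : realType) (L : set R) :
  upper_set L -> measurable_fun [set: measurableTypeR R] (\1_L : R -> R).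
Proof. by move=> /upper_set_measurable mL; exact: measurable_indic. Qed.

Lemma normr_indic_le1 (R : realType) (L : set R) x : `|\1_L x : R| <= 1.
Proof. by rewrite indicE; case: (_ \in _); rewrite ?normr1 ?normr0. Qed.

Lemma Rintegral_sum (R : realType) (mu : probability (measurableTypeR R) R)
    (N : nat) (h : nat -> R -> R) (M : nat -> R) :
  (forall j, measurable_fun setT (h j)) -> (forall j x, `|h j x| <= M j) ->
  \int[mu]_x (\sum_(j < N) h j x) = \sum_(j < N) \int[mu]_x h j x.
Proof.
move=> mh hM; elim: N => [|N IH].
  rewrite big_ord0; under eq_Rintegral do rewrite big_ord0.
  by rewrite Rintegral_cst// mul0r.
rewrite big_ord_recr/= -IH.
transitivity (\int[mu]_x (\sum_(j < N) h j x + h N x)).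
  by apply: eq_Rintegral => x _; rewrite big_ord_recr.
apply: RintegralD => //; last exact: bounded_integrable (mh N) (hM N).
apply: (@bounded_integrable _ _ _ (\sum_(j < N) M j)).
  exact: measurable_sum.
by move=> x; apply: le_trans (ler_norm_sum _ _ _) _; apply: ler_sum.
Qed.

Lemma exp_dominates (R : realType) (r K : R) : 0 < r ->
  exists n : nat, K < expR (r * n%:R).
Proof.
move=> r0; exists (Num.truncn (`|K| / r)).+1.
have := expR_ge1Dx (r * (Num.truncn (`|K| / r)).+1%:R).
have : `|K| / r < (Num.truncn (`|K| / r)).+1%:R by exact: truncnS_gt.
rewrite ltr_pdivrMr// mulrC => rK; apply: lt_le_trans.
by rewrite (le_lt_trans (ler_norm K))// (lt_le_trans rK)// lerDr.
Qed.

Lemma third_expn_small (R : realType) (e : R) : 0 < e ->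
  exists n : nat, 3^-1 ^+ n < e.
Proof.
move=> e0; have ln3 : 0 < ln (3 : R) by rewrite ln_gt0// ltr1n.
have [n ne] := exp_dominates e^-1 ln3.
exists n; rewrite exprVn -[ltRHS]invrK ltf_pV2 ?posrE ?exprn_gt0 ?invr_gt0//.
by move: ne; rewrite expRM_natr lnK ?posrE.
Qed.

(** Near-maximality against all half-lines is what later bounds the tail of the
    series for psi at time n by its n-th term alone. The constants 3/4 and
    4/3 are inverse to each other and leave a margin against the ratio 1/3
    of the weights 3^-p, whose tail is half of the current one. *)
Lemma almost_optimal_upper_set (R : realType) (u : set R -> R) (c : R) :
  0 < c -> (forall L, upper_set L -> `|u L| <= 1) ->
  (forall tau, (forall L, upper_set L -> `|u L| <= tau) -> c <= tau) ->
  exists L, [/\ upper_set L, 3 / 4 * c <= `|u L| &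
    forall L', upper_set L' -> `|u L'| <= 4 / 3 * `|u L|].
Proof.
move=> c0 u1 uc; pose E := [set `|u L| | L in @upper_set R].
have supE : has_sup E.
  split; first by exists `|u setT|, setT.
  by exists 1 => _ [L uL <-]; exact: u1.
have E_ub L : upper_set L -> `|u L| <= sup E.
  by move=> uL; apply: ub_le_sup; [exact: supE.2|exists L].
have cE : c <= sup E := uc _ E_ub.
have E4 : 0 < sup E / 4 by lra.
have [_ [L uL <-] supL] := sup_adherent E4 supE.
exists L; split => //; first by lra.
by move=> L' /E_ub; lra.
Qed.

(** If for each n the integral of g_n against some half-line is of order at least
    exp(- s1 n), then one fixed function of bounded variation has integrals
    against g_n that are not O(exp(- s n)). At time m p the terms up to p contribute
    at least v = 3^-p |int g 1_L| thanks to the choice of signs, and the later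
    ones at most (4/3) (1/2) v, by near-optimality of the half-line. *)
Lemma resonance (R : realType) (mu : probability (measurableTypeR R) R)
    (g : nat -> R -> R) (c s1 s : R) :
  (forall n, measurable_fun setT (g n)) -> (forall n x, `|g n x| <= 1) ->
  0 < c -> s1 < s ->
  (forall n tau, (forall L, upper_set L ->
      `|\int[mu]_x (g n x * \1_L x)| <= tau) -> c <= expR (s1 * n%:R) * tau) ->
  exists psip psim : R -> R,
    [/\ {homo psip : x y / x <= y}, {homo psim : x y / x <= y},
        forall x, `|psip x| <= 3 / 2 /\ `|psim x| <= 3 / 2 &
        forall K, exists n,
          K < `|expR (s * n%:R) * \int[mu]_x (g n x * (psip x - psim x))|].
Proof.
move=> mg g1 c0 s1s Hc; pose u n L := \int[mu]_x (g n x * \1_L x).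
have mgL n L : upper_set L -> measurable_fun setT (fun x => g n x * \1_L x).
  move=> uL; apply: measurable_funM; first exact: mg.
  exact: measurable_indic_upper.
have gL1 n L x : `|g n x * \1_L x| <= 1.
  by rewrite normrM mulr_ile1// normr_indic_le1.
have opt n : exists L, [/\ upper_set L,
    3 / 4 * (c * expR (- (s1 * n%:R))) <= `|u n L| &
    forall L', upper_set L' -> `|u n L'| <= 4 / 3 * `|u n L|].
  apply: almost_optimal_upper_set.
  - by rewrite mulr_gt0// expR_gt0.
  - by move=> L uL; apply: Rintegral_norm_le; [exact: mgL|exact: gL1].
  - move=> tau /Hc; rewrite expRN -ler_pdivrMl ?expR_gt0//.
    by rewrite mulrC.
have [L LP] := choice opt.
have uL n : upper_set (L n) by have [] := LP n.
have big p : exists n,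
    3 * 3 ^+ p * p.+1%:R < expR (s * n%:R) * `|u n (L n)|.
  have s1s0 : 0 < s - s1 by rewrite subr_gt0.
  have [n nP] := exp_dominates (4 * 3 ^+ p * p.+1%:R / c) s1s0.
  exists n; have [_ un _] := LP n.
  apply: (@lt_le_trans _ _ (expR (s * n%:R) *
      (3 / 4 * (c * expR (- (s1 * n%:R)))))); last first.
    by rewrite ler_pM2l ?expR_gt0.
  move: nP; rewrite ltr_pdivrMr// mulrBl expRD.
  by lra.
have [m mP] := choice big.
pose t j : R := 3^-1 ^+ j.
have t0 j : 0 < t j by rewrite exprn_gt0// invr_gt0.
pose w j n := t j * u n (L (m j)).
have [sigma sP] := sign_choice w m.
have c3 (b : bool) j : 0 <= (if sigma j == b then t j else 0) <= 3^-1 ^+ j.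
  by case: ifP => _; rewrite ?lexx ltW//= t0.
have [psip psip_nd psipP] := staircase (c3 false) (fun j => uL (m j)).
have [psim psim_nd psimP] := staircase (c3 true) (fun j => uL (m j)).
have psi1 x : `|psip x| <= 3 / 2 /\ `|psim x| <= 3 / 2.
  have := psipP 0%N x; have := psimP 0%N x.
  by rewrite !big_ord0 !subr0 expr0 mulr1.
exists psip, psim; split => // K.
have mpsi : measurable_fun setT (fun x => psip x - psim x).
  by apply: measurable_funB; exact: nondecreasing_measurable.
(* Only the partial sums are integrated term by term; the sup norm of the
   remainder bounds the rest. *)
have approx n N : `|\int[mu]_x (g n x * (psip x - psim x)) -
    \sum_(j < N) (-1) ^+ sigma j * w j n| <= 3 * 3^-1 ^+ N.
  pose h j x := (-1) ^+ sigma j * t j * (g n x * \1_(L (m j)) x).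
  have mh j : measurable_fun setT (h j).
    by apply: measurable_funM; [exact: measurable_cst|exact: mgL].
  have h1 j x : `|h j x| <= t j.
    rewrite !normrM normrX normrN1 expr1n mul1r (gtr0_norm (t0 j)).
    by rewrite ler_piMr ?(ltW (t0 j))// -normrM.
  have -> : \sum_(j < N) (-1) ^+ sigma j * w j n
          = \int[mu]_x (\sum_(j < N) h j x).
    rewrite (Rintegral_sum _ _ mh h1); apply: eq_bigr => j _.
    rewrite /h RintegralZl ?mulrA//.
    by apply: bounded_integrable; [exact: mgL|exact: gL1].
  have msum : measurable_fun setT (fun x => \sum_(j < N) h j x).
    exact: measurable_sum.
  have mgpsi : measurable_fun setT (fun x => g n x * (psip x - psim x)).
    exact: measurable_funM.
  rewrite -RintegralB//; last 2 first.
  - apply: (@bounded_integrable _ _ _ 3) => // x.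
    rewrite normrM (le_trans (ler_piMl _ (g1 n x)))//.
    by apply: le_trans (ler_normB _ _) _; have [] := psi1 x; lra.
  - apply: (@bounded_integrable _ _ _ (\sum_(j < N) t j)) => // x.
    by apply: le_trans (ler_norm_sum _ _ _) _; exact: ler_sum.
  apply: Rintegral_norm_le; first exact: measurable_funB.
  move=> x; move: (psipP N x) (psimP N x).
  set Sp := \sum_(j < N) _; set Sm := \sum_(j < N) _ => psipN psimN.
  have -> : \sum_(j < N) h j x = g n x * (Sp - Sm).
    rewrite -sumrB mulr_sumr; apply: eq_bigr => j _.
    by rewrite /h; case: (sigma j) => /=; ring.
  rewrite -mulrBr (_ : _ - _ - _ = (psip x - Sp) - (psim x - Sm)); last by ring.
  rewrite normrM (le_trans (ler_piMl _ (g1 n x)))//.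
  by apply: le_trans (ler_normB _ _) _; lra.
have lower p N : (p < N)%N -> 3^-1 * (t p * `|u (m p) (L (m p))|) <=
    `|\sum_(j < N) (-1) ^+ sigma j * w j (m p)|.
  move=> pN; set v := `|u _ _|.
  rewrite -(big_mkord xpredT (fun j => (-1) ^+ sigma j * w j (m p))).
  rewrite (big_cat_nat (leq0n p.+1) pN)/= big_mkord.
  have tail : `|\sum_(p.+1 <= j < N) (-1) ^+ sigma j * w j (m p)|
      <= 2 / 3 * (t p * v).
    apply: le_trans (ler_norm_sum _ _ _) _.
    apply: (@le_trans _ _ (\sum_(p.+1 <= j < N) t j * (4 / 3 * v))).
      apply: ler_sum => j _; rewrite !normrM normrX normrN1 expr1n mul1r.
      rewrite (gtr0_norm (t0 j)) ler_pM2l//.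
      by have [_ _] := LP (m p); apply; exact: uL.
    rewrite -mulr_suml -(subnKC pN) sum_third exprS -/(t p).
    have := t0 (p.+1 + (N - p.+1))%N; rewrite {1}/t.
    have v0 : 0 <= v by exact: normr_ge0.
    by have := t0 p; nra.
  have := sP p; rewrite {1}/w normrM (gtr0_norm (t0 p)) -/v => hd.
  have := lerB_normD (\sum_(j < p.+1) (-1) ^+ sigma j * w j (m p))
     (\sum_(p.+1 <= j < N) (-1) ^+ sigma j * w j (m p)).
  by lra.
have lowerI p : 3^-1 * (t p * `|u (m p) (L (m p))|) <=
    `|\int[mu]_x (g (m p) x * (psip x - psim x))|.
  set I := \int[mu]_x _; set v := _ * _; rewrite leNgt; apply/negP => Iv.
  (* The error 3 * 3^-N of the approximation must be less than the gap v - |I|. *)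
  have e0 : 0 < (v - `|I|) / 3 by lra.
  have [N NP] := third_expn_small e0.
  have NP' : 3^-1 ^+ maxn N p.+1 < (v - `|I|) / 3.
    apply: le_lt_trans NP; rewrite ler_wiXn2l ?leq_maxl//.
    by rewrite invf_le1// ler1n.
  have := lower p (maxn N p.+1); rewrite leq_max ltnSn orbT => /(_ isT).
  rewrite -/v; have := approx (m p) (maxn N p.+1); rewrite -/I.
  set S := \sum_(j < _) _ => SI vS.
  have := lerB_dist S I; rewrite distrC; lra.
(* The times m p were chosen so that the value at m p exceeds p + 1. *)
exists (m (Num.truncn `|K|)); set p := Num.truncn _.
rewrite normrM gtr0_norm ?expR_gt0//.
apply: (@lt_le_trans _ _ (expR (s * (m p)%:R) *
    (3^-1 * (t p * `|u (m p) (L (m p))|)))); last first.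
  by rewrite ler_pM2l ?expR_gt0.
have Kp : K < p.+1%:R by exact: le_lt_trans (ler_norm K) (truncnS_gt _).
apply: lt_trans Kp _.
have := mP p; have tp : t p * 3 ^+ p = 1.
  by rewrite /t -exprMn mulVf ?expr1n.
rewrite -(ltr_pM2l (t0 p)).
have -> : t p * (3 * 3 ^+ p * p.+1%:R) = (t p * 3 ^+ p) * (3 * p.+1%:R) by ring.
by rewrite tp; lra.
Qed.

(** * Mass of the intervals of monotonicity *)

(** L1 is the upper closure of Q; what is left of it above Q is still an
    upper set because Q is an interval. *)
Lemma interval_indic (R : realType) (Q : set R) : is_interval Q ->
  exists L1 L2, [/\ upper_set L1, upper_set L2 &
    forall x, \1_Q x = \1_L1 x - \1_L2 x :> R].
Proof.
move=> iQ; pose L1 := [set y | exists2 q, Q q & q <= y].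
have uL1 : upper_set L1.
  by move=> x y [q Qq qx] xy; exists q => //; exact: le_trans xy.
exists L1, (L1 `\` Q); split => //.
  move=> x y [L1x nQx] xy; split; first exact: uL1 xy.
  by move=> Qy; apply: nQx; have [q Qq qx] := L1x; apply: (iQ q y); rewrite ?qx.
move=> x; rewrite !indicE; have [Qx|nQx] := pselect (Q x).
  have L1x : L1 x by exists x.
  have nDx : ~ (L1 `\` Q) x by case.
  by rewrite (mem_set Qx) (mem_set L1x) (memNset nDx) subr0.
have [L1x|nL1x] := pselect (L1 x).
  have Dx : (L1 `\` Q) x by [].
  by rewrite (memNset nQx) (mem_set L1x) (mem_set Dx) subrr.
have nDx : ~ (L1 `\` Q) x by case.
by rewrite (memNset nQx) (memNset nL1x) (memNset nDx) subrr.
Qed.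

Lemma monotone_preimage_interval (R : realType) (f : R -> R) (A W : set R) :
  is_interval A -> strictly_monotone_on A f -> is_interval W ->
  is_interval (A `&` f @^-1` W).
Proof.
move=> iA mf iW x y [Ax Wx] [Ay Wy] z /andP[xz zy].
have Az : A z by apply: (iA x y) => //; rewrite xz.
split => //=.
case: mf => mf.
  have le_f s t : A s -> A t -> s <= t -> f s <= f t.
    by move=> As At; rewrite le_eqVlt => /predU1P[->//|/mf-/(_ As At)/ltW].
  by apply: (iW (f x) (f y)) => //; rewrite !le_f.
have ge_f s t : A s -> A t -> s <= t -> f t <= f s.
  by move=> As At; rewrite le_eqVlt => /predU1P[->//|/mf-/(_ As At)/ltW].
by apply: (iW (f y) (f x)) => //; rewrite !ge_f.
Qed.

Lemma measure_bigcup_ord_le (R : realType)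
    (mu : probability (measurableTypeR R) R) (N : nat)
    (A : 'I_N -> set R) (x : R) :
  (forall k, measurable (A k : set (measurableTypeR R))) ->
  (forall k, (mu (A k) <= x%:E)%E) ->
  (mu (\bigcup_(k in [set: 'I_N]) A k) <= (N%:R * x)%:E)%E.
Proof.
move=> mA Ax.
have -> : \bigcup_(k in [set: 'I_N]) A k = \big[setU/set0]_(k <- enum 'I_N) A k.
  by rewrite -bigcup_seq; congr bigcup; apply/seteqP; split => k//= _;
     rewrite mem_enum.
suff sub s : (mu (\big[setU/set0]_(k <- s) A k) <= ((size s)%:R * x)%:E)%E.
  by have := sub (enum 'I_N); rewrite size_enum_ord.
elim: s => [|k s IH]; first by rewrite big_nil measure0 mul0r.
rewrite big_cons; apply: le_trans (measureU2 _ _ _) _ => //=.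
  exact: bigsetU_measurable.
by rewrite -natr1 mulrDl mul1r EFinD addeC leeD.
Qed.

(** Q is the union of an interval that T sends into J and one that T sends outside
    J. On each, 1_J o T - theta is a nonzero constant, so its integral controls
    the mass. The hypothesis on Q is monotonicity of T on Q, in a form that
    passes to compositions with maps monotone on the branches. *)
Lemma interval_mass (R : realType) (mu : probability (measurableTypeR R) R)
    (T : R -> R) (J Q : set R) (theta tau : R) :
  measurable_fun [set: measurableTypeR R] T -> upper_set J ->
  0 < theta < 1 ->
  (forall L, upper_set L ->
    `|\int[mu]_x ((\1_J (T x) - theta) * \1_L x)| <= tau) ->
  (forall W, is_interval W -> is_interval (Q `&` T @^-1` W)) ->
  (mu Q <= (2 * tau / (1 - theta) + 2 * tau / theta)%:E)%E.
Proof.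
move=> mT uJ /andP[th0 th1] Htau iQ.
have mJ : measurable (J : set (measurableTypeR R)) := upper_set_measurable uJ.
have iJ : is_interval J by move=> x y Jx _ z /andP[xz _]; exact: uJ xz.
have iJc : is_interval (~` J).
  by move=> x y _ nJy z /andP[_ zy] Jz; apply: nJy; exact: uJ zy.
have mg : measurable_fun setT (fun x => \1_J (T x) - theta).
  apply: measurable_funB => //.
  have m1 : measurable_fun [set: measurableTypeR R] (\1_J : R -> R).
    exact: measurable_indic.
  exact: (measurableT_comp m1 mT).
have g1 x : `|\1_J (T x) - theta| <= 1.
  by rewrite indicE ler_norml; case: (_ \in _) => /=; apply/andP; split; lra.
have mgI (A : set R) : measurable (A : set (measurableTypeR R)) ->
    measurable_fun setT (fun x => (\1_J (T x) - theta) * \1_A x).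
  by move=> mA; apply: measurable_funM => //; exact: measurable_indic.
have gI1 (A : set R) x : `|(\1_J (T x) - theta) * \1_A x| <= 1.
  by rewrite normrM mulr_ile1// normr_indic_le1.
have small A : is_interval A ->
    `|\int[mu]_x ((\1_J (T x) - theta) * \1_A x)| <= 2 * tau.
  move=> /interval_indic[L1 [L2 [uL1 uL2 AE]]].
  have -> : \int[mu]_x ((\1_J (T x) - theta) * \1_A x) =
      \int[mu]_x ((\1_J (T x) - theta) * \1_L1 x) -
      \int[mu]_x ((\1_J (T x) - theta) * \1_L2 x).
    rewrite -RintegralB//; first by apply: eq_Rintegral => x _; rewrite AE mulrBr.
      by apply: bounded_integrable (gI1 L1); apply: mgI; exact: upper_set_measurable.
    by apply: bounded_integrable (gI1 L2); apply: mgI; exact: upper_set_measurable.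
  apply: le_trans (ler_normB _ _) _.
  by have := Htau _ uL1; have := Htau _ uL2; lra.
have mass A (v : R) : is_interval A -> 0 < `|v| ->
    (forall x, A x -> \1_J (T x) - theta = v) ->
    (mu A <= (2 * tau / `|v|)%:E)%E.
  move=> iA v0 Av; have mA := is_interval_measurable iA.
  have := small A iA; rewrite (_ : \int[mu]_x _ = v * fine (mu A)).
    rewrite normrM (ger0_norm (fine_ge0 _))// mulrC -ler_pdivlMr// => H.
    by rewrite -[mu A]fineK ?fin_num_measure// lee_fin.
  rewrite -Rintegral_cst// [RHS]Rintegral_mkcond; apply: eq_Rintegral => x _.
  rewrite patchE [\1_A x]indicE; have [Ax|nAx] := pselect (A x).
    by rewrite !(mem_set Ax) mulr1 Av.
  by rewrite !(memNset nAx) mulr0.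
have -> : Q = (Q `&` T @^-1` J) `|` (Q `&` T @^-1` (~` J)).
  by rewrite -setIUr -preimage_setU setUv preimage_setT setIT.
apply: le_trans (measureU2 _ _ _) _.
- by apply: is_interval_measurable; exact: iQ.
- by apply: is_interval_measurable; exact: iQ.
rewrite EFinD; apply: leeD.
- rewrite -{1}(ger0_norm (_ : 0 <= 1 - theta)); last by lra.
  apply: mass; first exact: iQ.
    by rewrite ger0_norm; lra.
  by move=> x [_ Jx]; rewrite indicE mem_set.
- rewrite -(gtr0_norm th0) -normrN; apply: mass; first exact: iQ.
    by rewrite normrN gtr0_norm.
  by move=> x [_ nJx]; rewrite indicE memNset// sub0r.
Qed.

(** Q is an interval of initial conditions whose image at time i is still short;
    n is the number of steps left. The image can be cut by the ends of the
    branches, which splits Q into at most N pieces; but if this happens then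
    the image, being shorter than eta and not contained in one branch, lies
    entirely in V. So the number of pieces is at most N to the number of visits
    to V, which H bounds. Carrying the length of the image as a condition on
    all pairs x, x' makes the induction step the plain chain rule. *)
Lemma pieces_mass (R : realType) (mu : probability (measurableTypeR R) R)
    (N : nat) (B : 'I_N -> set R) (F u : R -> R) (V : set R)
    (eta kappa : R) (m : nat) :
  (forall k, is_interval (B k)) ->
  (forall k, strictly_monotone_on (B k) F) ->
  (forall k x y z, B k x -> B k y -> B k z ->
     `|x - z| <= eta -> `|y - z| <= eta ->
     `|F x - F y| <= expR (u z) * `|x - y|) ->
  (forall z, 0 <= u z) ->
  (forall k z x, B k z -> ~ B k x -> `|x - z| <= eta -> V z) ->
  0 <= kappa ->
  (forall Q, (forall W, is_interval W -> is_interval (Q `&` iter m F @^-1` W)) ->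
     (mu Q <= kappa%:E)%E) ->
  forall (n i : nat) (Q E : set R) (H : R), (i + n = m)%N -> 0 <= H ->
  measurable (E : set (measurableTypeR R)) ->
  (forall W, is_interval W -> is_interval (Q `&` iter i F @^-1` W)) ->
  (forall z, Q z -> E z -> let y := iter i F z in
    [/\ forall j, (j < n)%N -> exists k, B k (iter j F y),
        forall x x', Q x -> Q x' -> `|iter i F x - iter i F x'| *
          expR (\sum_(j < n) u (iter j F y)) <= eta &
        N%:R ^+ (\sum_(j < n) (iter j F y \in V)) <= H]) ->
  (mu (Q `&` E) <= (H * kappa)%:E)%E.
Proof.
move=> iB mB eB u0 BV k0 muk; elim => [|n IH] i Q E H inm H0 mE iQ admE.
  have [[z [Qz Ez]]|QE0] := pselect (exists z, Q z /\ E z); last first.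
    rewrite (_ : Q `&` E = set0) ?measure0 ?lee_fin ?mulr_ge0//.
    by apply/seteqP; split => // z [Qz Ez]; apply: QE0; exists z.
  have [_ _] := admE z Qz Ez; rewrite big_ord0 expr0 => H1.
  have mQ : measurable (Q : set (measurableTypeR R)).
    apply: is_interval_measurable; rewrite -[Q]setIT -(preimage_setT (iter i F)).
    by apply: iQ.
  apply: (@le_trans _ _ (mu Q)).
    by apply: le_measure; rewrite ?inE//; exact: measurableI.
  apply: (@le_trans _ _ kappa%:E); last by rewrite lee_fin ler_peMl.
  by apply: muk => W iW; rewrite -inm addn0; exact: iQ.
pose P k := Q `&` iter i F @^-1` B k.
have iP k W : is_interval W -> is_interval (P k `&` iter i.+1 F @^-1` W).
  move=> iW; have -> : P k `&` iter i.+1 F @^-1` W =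
      Q `&` iter i F @^-1` (B k `&` F @^-1` W).
    by apply/seteqP; split => x; rewrite /P /= -/(iter i.+1 F x) iterS;
      tauto.
  by apply: iQ; exact: monotone_preimage_interval.
have sums (z : R) : let y := iter i F z in
    \sum_(j < n.+1) u (iter j F y) =
      u y + \sum_(j < n) u (iter j F (iter i.+1 F z)) /\
    (\sum_(j < n.+1) (iter j F y \in V) =
      (y \in V) + \sum_(j < n) (iter j F (iter i.+1 F z) \in V))%N.
  by move=> y; rewrite !big_ord_recl; split; congr (_ + _)%R;
    apply: eq_bigr => j _; rewrite lift0 iterSr.
have admP k H' : (forall z, Q z -> E z -> B k (iter i F z) ->
      N%:R ^+ (\sum_(j < n) (iter j F (iter i.+1 F z) \in V)) <= H') ->
    0 <= H' -> (mu (P k `&` E) <= (H' * kappa)%:E)%E.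
  move=> HH' H'0; apply: (IH i.+1) => //; first by rewrite addSnnS.
    by move=> W iW; exact: iP.
  move=> z [Qz Bz] Ez y; have [orbz expz _] := admE z Qz Ez.
  have [sz _] := sums z; split; last exact: HH'.
    by move=> j jn; rewrite /y iterS -iterSr; exact: orbz.
  move=> x x' [Qx Bx] [Qx' Bx'].
  have close v : Q v -> `|iter i F v - iter i F z| <= eta.
    move=> Qv; apply: le_trans (expz _ _ Qv Qz).
    rewrite ler_peMr// -[leLHS]expR0 ler_expR.
    by apply: sumr_ge0.
  apply: le_trans (expz x x' Qx Qx'); rewrite sz expRD mulrA ler_pM2r ?expR_gt0//.
  by rewrite mulrC; apply: eB Bx Bx' Bz _ _; exact: close.
have [[k Qk]|nQk] := pselect (exists k, forall x, Q x -> B k (iter i F x)).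
  have -> : Q = P k.
    by apply/seteqP; split => [x Qx|x []//]; split => //; exact: Qk.
  apply: admP => // z Qz Ez Bz; have [_ _] := admE z Qz Ez.
  apply: le_trans; have [_ ->] := sums z.
  have N0 : (0 < N)%N by exact: leq_ltn_trans (ltn_ord k).
  by rewrite ler_weXn2l ?ler1n// leq_addl.
have QE : Q `&` E = \bigcup_(k in [set: 'I_N]) (P k `&` E).
  apply/seteqP; split => [z [Qz Ez]|z [k _ [[Qz _] Ez]]]; last by split.
  have [orbz _ _] := admE z Qz Ez; have [k Bk] := orbz 0%N isT.
  by exists k.
have [N0|N0] := posnP N.
  rewrite QE (_ : \bigcup_(k in _) _ = set0) ?measure0 ?lee_fin ?mulr_ge0//.
  by apply/seteqP; split => // z [k _ _]; have := ltn_ord k; rewrite {2}N0.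
have Nn0 : (N%:R : R) != 0 by rewrite pnatr_eq0 -lt0n.
rewrite QE -[H](mulVKf Nn0) -mulrA; apply: measure_bigcup_ord_le => k.
  apply: measurableI => //; apply: is_interval_measurable.
  rewrite -[P k]setIT -(preimage_setT (iter i.+1 F)); exact: iP.
apply: admP; last by rewrite mulr_ge0// invr_ge0.
move=> z Qz Ez Bz; have [_ expz] := admE z Qz Ez.
have [_ ->] := sums z.
have [x Qx nBx] : exists2 x, Q x & ~ B k (iter i F x).
  apply: contrapT => nx; apply: nQk; exists k => x Qx.
  by apply: contrapT => nBx; apply: nx; exists x.
have Vz : V (iter i F z).
  apply: BV Bz nBx _; apply: le_trans (expz _ _ Qx Qz).
  by rewrite ler_peMr// -[leLHS]expR0 ler_expR; apply: sumr_ge0.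
by rewrite mem_set// add1n exprS -ler_pdivlMl ?ltr0n.
Qed.

(** * Points with a typical derivative *)

Lemma measurable_preimage (R : realType) (F : R -> R) (A : set R) :
  measurable_fun [set: measurableTypeR R] F ->
  measurable (A : set (measurableTypeR R)) ->
  measurable (F @^-1` A : set (measurableTypeR R)).
Proof. by move=> mF mA; have := mF measurableT A mA; rewrite setTI. Qed.

Lemma measurable_iter (R : realType) (F : R -> R) (j : nat) :
  measurable_fun [set: measurableTypeR R] F ->
  measurable_fun [set: measurableTypeR R] (iter j F).
Proof.
move=> mF; elim: j => [|j IH]; first exact: measurable_id.
exact: (measurableT_comp mF IH).
Qed.

Lemma invariant_iter (R : realType) (mu : probability (measurableTypeR R) R)
    (F : R -> R) (j : nat) (A : set R) :
  measurable_fun [set: measurableTypeR R] F ->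
  (forall A, measurable (A : set (measurableTypeR R)) -> mu (F @^-1` A) = mu A) ->
  measurable (A : set (measurableTypeR R)) -> mu (iter j F @^-1` A) = mu A.
Proof.
move=> mF invF; elim: j A => [//|j IH] A mA.
by rewrite -(invF A mA) -(IH (F @^-1` A))//; exact: measurable_preimage.
Qed.

Lemma integral_iter (R : realType) (mu : probability (measurableTypeR R) R)
    (F w : R -> R) (j : nat) :
  measurable_fun [set: measurableTypeR R] F ->
  (forall A, measurable (A : set (measurableTypeR R)) -> mu (F @^-1` A) = mu A) ->
  measurable_fun [set: measurableTypeR R] w -> (forall x, 0 <= w x) ->
  (\int[mu]_x (w (iter j F x))%:E = \int[mu]_x (w x)%:E)%E.
Proof.
move=> mF invF mw w0; have mFj := measurable_iter j mF.
have mw' : measurable_fun [set: measurableTypeR R] (EFin \o w).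
  by apply/measurable_EFinP; exact: mw.
have w0' : {in [set: measurableTypeR R], forall y, (0 <= (EFin \o w) y)%E}.
  by move=> y _; rewrite lee_fin.
have := @ge0_integral_pushforward _ _ (measurableTypeR R) (measurableTypeR R) R
  (iter j F) mFj mu setT (EFin \o w) measurableT mw' w0'.
rewrite preimage_setT => <-.
pose Fj : {mfun measurableTypeR R >-> measurableTypeR R} :=
  HB.pack (iter j F) (isMeasurableFun.Build _ _
    (measurableTypeR R) (measurableTypeR R) (iter j F) mFj).
apply: (@eq_measure_integral _ _ _ _ mu (distribution mu Fj)) => A mA _.
exact: (invariant_iter j mF invF mA).
Qed.

(** Markov's inequality for the Birkhoff sum of w, whose mean is at most n W by
    invariance. The bound does not depend on n. *)
Lemma typical_orbits (R : realType) (mu : probability (measurableTypeR R) R)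
    (F w : R -> R) (U : set R) (W s : R) (n : nat) :
  measurable_fun [set: measurableTypeR R] F ->
  (forall A, measurable (A : set (measurableTypeR R)) -> mu (F @^-1` A) = mu A) ->
  measurable_fun [set: measurableTypeR R] w -> (forall x, 0 <= w x) ->
  (\int[mu]_x (w x)%:E <= W%:E)%E -> 0 < s ->
  measurable (U : set (measurableTypeR R)) -> mu (~` U) = 0%E ->
  let E := [set z | \sum_(j < n) w (iter j F z) <= s * n%:R /\
                    forall j, (j < n)%N -> U (iter j F z)] in
  measurable (E : set (measurableTypeR R)) /\ ((1 - W / s)%:E <= mu E)%E.
Proof.
move=> mF invF mw w0 Ww s0 mU U0 E.
have mwj j : measurable_fun [set: measurableTypeR R] (w \o iter j F).
  exact: (measurableT_comp mw (measurable_iter j mF)).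
pose S z := \sum_(j < n) w (iter j F z).
have mS : measurable_fun [set: measurableTypeR R] S.
  by apply: measurable_sum => j; exact: mwj.
pose A := [set z | ~ S z <= s * n%:R].
have mA : measurable (A : set (measurableTypeR R)).
  rewrite (_ : A = ~` [set z | S z <= s * n%:R])//; apply: measurableC.
  rewrite -[[set z | _]]setTI; apply: measurable_fun_le => //.
pose B j := iter j F @^-1` (~` U).
have mB j : measurable (B j : set (measurableTypeR R)).
  by apply: measurable_preimage; [exact: measurable_iter|exact: measurableC].
have B0 j : mu (B j) = 0%E by rewrite invariant_iter//; exact: measurableC.
have EC : ~` E = A `|` \big[setU/set0]_(j < n) B j.
  rewrite -bigcup_mkord; apply/seteqP; split => z.
    move=> nE; have [Sz|Sz] := pselect (S z <= s * n%:R); last by left.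
    right; apply: contrapT => nB; apply: nE; split => // j jn.
    by apply: contrapT => nU; apply: nB; exists j.
  by case=> [Az [Sz _]//|[j jn nU] [_ /(_ j jn)]].
have mEC : measurable (~` E : set (measurableTypeR R)).
  by rewrite EC; apply: measurableU => //; exact: bigsetU_measurable.
have mE : measurable (E : set (measurableTypeR R)).
  by rewrite -[E]setCK; exact: measurableC.
split => //.
have muA : (mu A <= (W / s)%:E)%E.
  have [n0|n0] := posnP n.
    rewrite (_ : A = set0); last first.
      by apply/seteqP; split => // z; rewrite /A /S /= n0 big_ord0 mulr0.
    rewrite measure0 lee_fin divr_ge0 ?(ltW s0)// -lee_fin (le_trans _ Ww)//.
    by apply: integral_ge0 => x _; rewrite lee_fin.
  have sn : 0 < s * n%:R by rewrite mulr_gt0// ltr0n.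
  have -> : W / s = (s * n%:R)^-1 * (n%:R * W).
    by field; rewrite ?gt_eqF// ltr0n.
  rewrite EFinM lee_pdivlMl//.
  apply: (@le_trans _ _ (\int[mu]_(x in A) (S x)%:E)%E).
    rewrite -integral_cst//; apply: ge0_le_integral => //.
    - by move=> x _; rewrite lee_fin ltW.
    - by apply/measurable_EFinP; exact: measurable_funTS.
    - by move=> x /negP; rewrite -ltNge lee_fin => /ltW.
  apply: (@le_trans _ _ (\int[mu]_x (S x)%:E)%E).
    apply: ge0_subset_integral => //; first exact/measurable_EFinP.
    by move=> x _; rewrite lee_fin sumr_ge0.
  under eq_integral do rewrite /S -sumEFin.
  rewrite ge0_integral_sum//; last 2 first.
  - by move=> j; apply/measurable_EFinP; exact: mwj.
  - by move=> j x _; rewrite lee_fin.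
  under eq_bigr do rewrite integral_iter//.
  apply: le_trans (lee_sum _ (fun _ _ => Ww)) _.
  by rewrite sumEFin sumr_const card_ord mulr_natl.
have muEC : (mu (~` E) <= (W / s)%:E)%E.
  rewrite EC; apply: le_trans (measureU2 _ _ _) _ => //.
    exact: bigsetU_measurable.
  rewrite -[leRHS]adde0; apply: leeD => //.
  apply: le_trans (Boole_inequality _ _) _ => //.
  by rewrite big1// => j _; exact: B0.
move: muEC; rewrite (probability_setC mu mE) -[mu E]fineK ?fin_num_measure//.
by rewrite -EFinB !lee_fin; lra.
Qed.

(** * Scale at which branches are almost affine *)

Definition branches (R : realType) (N : nat) (c d : 'I_N -> R) : set R :=
  \bigcup_(k in [set: 'I_N]) `]c k, d k[.

(** The points whose eta-neighbourhood may leave their branch: a short interval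
    that is cut consists of such points. *)
Definition boundary_layer (R : realType) (N : nat) (c d : 'I_N -> R) (eta : R)
  : set R := \bigcup_(k in [set: 'I_N])
    (`]c k, d k[ `\` `]c k + eta, d k - eta[).

Lemma measurable_bigcup_ord (R : realType) (N : nat) (A : 'I_N -> set R) :
  (forall k, measurable (A k : set (measurableTypeR R))) ->
  measurable (\bigcup_(k in [set: 'I_N]) A k : set (measurableTypeR R)).
Proof. by move=> mA; apply: fin_bigcup_measurable. Qed.

Lemma measurable_branches (R : realType) (N : nat) (c d : 'I_N -> R) :
  measurable (branches c d : set (measurableTypeR R)).
Proof. by apply: measurable_bigcup_ord => k; exact: measurable_itv. Qed.

Lemma measurable_boundary_layer (R : realType) (N : nat) (c d : 'I_N -> R) eta :
  measurable (boundary_layer c d eta : set (measurableTypeR R)).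
Proof.
by apply: measurable_bigcup_ord => k; apply: measurableD; exact: measurable_itv.
Qed.

Lemma boundary_layerP (R : realType) (N : nat) (c d : 'I_N -> R) eta k z x :
  `]c k, d k[%classic z -> ~ `]c k, d k[%classic x -> `|x - z| <= eta ->
  boundary_layer c d eta z.
Proof.
move=> Bz nBx xz; exists k => //; split => // Bz'; apply: nBx.
move: Bz' xz; rewrite /= !in_itv/= ler_norml => /andP[cz zd] /andP[xz zx].
by apply/andP; split; lra.
Qed.

Lemma boundary_layer_subset (R : realType) (N : nat) (c d : 'I_N -> R) eta eta' :
  eta <= eta' -> boundary_layer c d eta `<=` boundary_layer c d eta'.
Proof.
move=> ee z [k _ [Bz nz]]; exists k => //; split => // Bz'; apply: nz.
by move: Bz'; rewrite /= !in_itv/= => /andP[cz zd]; apply/andP; split; lra.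
Qed.

(** The layers decrease to the empty set as eta tends to 0, because a point
    belongs to one branch only, at positive distance from its ends. *)
Lemma boundary_layer_small (R : realType)
    (mu : probability (measurableTypeR R) R) (N : nat) (c d : 'I_N -> R) e eta0 :
  trivIset setT (fun k => `]c k, d k[%classic) ->
  0 < e -> 0 < eta0 -> exists eta, [/\ 0 < eta, eta <= eta0 &
    (mu (boundary_layer c d eta) <= e%:E)%E].
Proof.
move=> tI e0 eta00; pose V n := boundary_layer c d (n.+1%:R^-1 : R).
have V0 : \bigcap_n V n = set0.
  apply/seteqP; split => // z Vz.
  have [k _ [Bz _]] := Vz 0%N I.
  have zcd : 0 < Num.min (z - c k) (d k - z).
    by move: Bz; rewrite /= in_itv/= lt_min !subr_gt0 => /andP[-> ->].
  have [n _ nP] := near_infty_natSinv_lt (PosNum zcd).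
  have [k' _ [Bz' nz]] := Vz n I.
  have kk' : k = k' by apply: tI => //; exists z.
  have := nP n (leqnn n); rewrite /= lt_min => /andP[nc nd].
  apply: nz; rewrite -kk' /= in_itv/=; move: nc nd; set i := _^-1 => nc nd.
  by apply/andP; split; lra.
have Vnd : {homo V : n m / (n <= m)%N >-> (m <= n)%O}.
  move=> n m nm; apply/subsetPset; apply: boundary_layer_subset.
  by rewrite lef_pV2 ?posrE// ler_nat.
have mV n : measurable (V n : set (measurableTypeR R)).
  exact: measurable_boundary_layer.
have cV := @nonincreasing_cvg_mu _ (measurableTypeR R) R mu V.
have {}cV : mu (V n) @[n --> \oo] --> mu set0.
  rewrite -V0; apply: cV => //; last by rewrite V0.
  by rewrite (le_lt_trans (probability_le1 _ _))// ltry.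
rewrite measure0 in cV.
have [n1 _ n1P] : \forall n \near \oo, (mu (V n) < e%:E)%E.
  have /(open_ereal_lt' (x := 0%E)) : (0 < e%:E)%E by rewrite lte_fin.
  exact: cV.
have [n2 _ n2P] := near_infty_natSinv_lt (PosNum eta00).
pose n := maxn n1 n2; exists n.+1%:R^-1; split.
- by rewrite invr_gt0.
- by apply: ltW; apply: n2P; rewrite /= leq_maxr.
- by apply: ltW; apply: n1P; rewrite /= leq_maxl.
Qed.

(** By the Lipschitz bound |f' w| <= |f' z| + e <= (1 + e) |f' z| for w close to z,
    since |f' z| >= 1; and 1 + e <= exp e. *)
Lemma local_expansion (R : realType) (N : nat) (c d : 'I_N -> R) (f : R -> R)
    (B e : R) :
  (forall k x, `]c k, d k[%classic x -> [/\ derivable f x 1, 1 <= `|derive1 f x| &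
    forall y, `]c k, d k[%classic y ->
      `|derive1 f x - derive1 f y| <= B * `|x - y|]) ->
  0 < e -> exists2 eta0, 0 < eta0 & forall k x y z,
    `]c k, d k[%classic x -> `]c k, d k[%classic y -> `]c k, d k[%classic z ->
    `|x - z| <= eta0 -> `|y - z| <= eta0 ->
    `|f x - f y| <= expR (e + ln `|derive1 f z|) * `|x - y|.
Proof.
move=> fP e0; exists (e / (`|B| + 1)).
  by rewrite divr_gt0// ltr_wpDl.
move=> k x y z Bx By Bz xz yz.
have fd w : `]c k, d k[%classic w -> is_derive w 1 f (derive1 f w).
  by move=> Bw; have [fw _ _] := fP k w Bw; rewrite derive1E; exact: derivableP.
have [w wxy ->] := mean_value_itvoo fd Bx By.
rewrite ler_wpM2r//.
have Bw : `]c k, d k[%classic w.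
  move: Bx By wxy; rewrite /= !in_itv/= => /andP[cx xd] /andP[cy yd].
  by move=> /orP[]/andP[? ?]; apply/andP; split; lra.
have wz : `|w - z| <= e / (`|B| + 1).
  move: xz yz wxy; rewrite !ler_norml => /andP[? ?] /andP[? ?].
  by move=> /orP[]/andP[? ?]; apply/andP; split; lra.
have [_ z1 zL] := fP k z Bz.
have := zL w Bw => zw.
have {}zw : `|derive1 f w| <= `|derive1 f z| + e.
  rewrite -lerBlDl; apply: le_trans (lerB_dist _ _) _; rewrite distrC.
  apply: le_trans zw _; rewrite distrC.
  apply: (@le_trans _ _ ((`|B| + 1) * `|w - z|)).
    by rewrite ler_wpM2r// (le_trans (ler_norm B))// lerDl.
  by rewrite mulrC -ler_pdivlMr// ltr_wpDl.
rewrite expRD lnK ?posrE ?(lt_le_trans ltr01)//.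
have := expR_ge1Dx e; set D := `|derive1 f z| in z1 zw *.
by have := expR_gt0 e; nra.
Qed.

(** * Lower bound for the oscillation at time n *)

Lemma segment_cover (R : realType) (a b l : R) : a <= b -> 0 < l ->
  exists (p : nat) (A : 'I_p -> set R), [/\ p%:R <= (b - a) / l + 1,
    forall k, is_interval (A k),
    forall k x y, A k x -> A k y -> `|x - y| <= l &
    `[a, b] `<=` \bigcup_(k in [set: 'I_p]) A k].
Proof.
move=> ab l0; pose p := (Num.truncn ((b - a) / l)).+1.
have q0 : 0 <= (b - a) / l by rewrite divr_ge0 ?subr_ge0 ?(ltW l0).
exists p, (fun k => [set x | a + k%:R * l <= x <= a + k.+1%:R * l]); split.
- by rewrite /p -natr1 lerD2r truncn_le.
- move=> k x y /= /andP[ax xl] /andP[ay yl] z /andP[xz zy] /=.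
  by rewrite (le_trans ax xz) (le_trans zy yl).
- move=> k x y /= /andP[ax xl] /andP[ay yl].
  move: xl yl; rewrite -natr1 mulrDl mul1r => xl yl.
  by rewrite ler_norml; apply/andP; split; lra.
- move=> x; rewrite /= in_itv/= => /andP[ax xb].
  have x0 : 0 <= (x - a) / l by rewrite divr_ge0 ?subr_ge0 ?(ltW l0).
  have kp : (Num.truncn ((x - a) / l) < p)%N.
    rewrite ltnS; apply: le_truncn.
    by rewrite ler_pM2r ?invr_gt0// lerB.
  exists (Ordinal kp) => //=; have /andP[] := truncn_itv x0.
  rewrite ler_pdivlMr// ltr_pdivrMr// => ? /ltW ?.
  by apply/andP; split; lra.
Qed.

(** If no half-line detects an oscillation larger than tau, interval_mass bounds
    the mass of each piece by a multiple of tau, and pieces_mass that of the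
    typical points, which is at least e / s'. Any s1 above the Lyapunov exponent
    leaves room for all the losses in the counting of pieces. *)
Lemma orbit_estimate (R : realType) (mu : probability (measurableTypeR R) R)
    (a b : R) (N : nat) (c d : 'I_N -> R) (f F lnD : R -> R) (B Lam s1 theta : R)
    (J : set R) :
  a < b -> mu (~` `[a, b]) = 0%E ->
  trivIset setT (fun k => `]c k, d k[%classic) ->
  mu (~` branches c d) = 0%E ->
  (forall k, strictly_monotone_on `]c k, d k[ F) ->
  (forall k x, `]c k, d k[%classic x -> F x = f x) ->
  (forall k x, `]c k, d k[%classic x -> [/\ derivable f x 1, 1 <= `|derive1 f x| &
    forall y, `]c k, d k[%classic y ->
      `|derive1 f x - derive1 f y| <= B * `|x - y|]) ->
  measurable_fun [set: measurableTypeR R] F ->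
  (forall A, measurable (A : set (measurableTypeR R)) -> mu (F @^-1` A) = mu A) ->
  measurable_fun [set: measurableTypeR R] lnD -> (forall x, 0 <= lnD x) ->
  (forall k x, `]c k, d k[%classic x -> lnD x = ln `|derive1 f x|) ->
  (\int[mu]_x (lnD x)%:E <= Lam%:E)%E -> Lam < s1 ->
  upper_set J -> 0 < theta < 1 ->
  exists2 C : R, 0 < C & forall n tau, (forall L, upper_set L ->
      `|\int[mu]_x ((\1_J (iter n F x) - theta) * \1_L x)| <= tau) ->
    C <= expR (s1 * n%:R) * tau.
Proof.
move=> ab muab tI muU mF Ff fP mesF invF mlnD lnD0 lnDE intD Ls1 uJ theta01.
(* The slack s1 - Lam is spent in four parts: one on the distortion, one on
   the mass of the layer, one on Markov's inequality, one on the cuts. *)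
pose e := (s1 - Lam) / 4; have e0 : 0 < e by rewrite /e; lra.
have Lam0 : 0 <= Lam.
  by rewrite -lee_fin (le_trans _ intD)// integral_ge0// => x _; rewrite lee_fin.
pose s' := Lam + 3 * e; have s'0 : 0 < s' by rewrite /s'; lra.
have [N0|N0] := posnP N.
  have : mu (~` branches c d) = 1%E.
    rewrite (_ : ~` _ = setT); first exact: probability_setT.
    apply/seteqP; split => // x _ [k _ _].
    by have := ltn_ord k; rewrite {2}N0.
  by rewrite muU => /eqP; rewrite eqe eq_sym oner_eq0.
have lnN0 : 0 <= ln (N%:R : R) by rewrite ln_ge0// ler1n.
(* The weight t of a visit to the layer makes a Birkhoff sum of w below s' n
   allow at most s' n / t visits, hence at most N ^ (s' n / t) <= exp(e n) pieces. *)
pose t := (ln N%:R + 1) * s' / e.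
have t0 : 0 < t by rewrite /t divr_gt0// mulr_gt0// ltr_wpDl.
have [eta0 eta00 expand] := local_expansion fP e0.
have [eta [eta_gt0 eta_le Veta]] := boundary_layer_small mu tI (divr_gt0 e0 t0) eta00.
pose V := boundary_layer c d eta.
have mV : measurable (V : set (measurableTypeR R)) by exact: measurable_boundary_layer.
pose u z := e + lnD z; pose w z := u z + t * \1_V z.
have u0 z : 0 <= u z by rewrite addr_ge0// ltW.
have w0 z : 0 <= w z.
  by rewrite addr_ge0// mulr_ge0 ?(ltW t0)// indicE; case: (_ \in _).
have m1V : measurable_fun [set: measurableTypeR R] (\1_V : R -> R).
  by apply: measurable_indic; exact: mV.
have mw : measurable_fun [set: measurableTypeR R] w.
  apply: measurable_funD; first by apply: measurable_funD => //; exact: measurable_cst.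
  by apply: measurable_funM => //; exact: measurable_cst.
have intw : (\int[mu]_x (w x)%:E <= (Lam + 2 * e)%:E)%E.
  have mcst (r : R) : measurable_fun [set: measurableTypeR R] (fun=> r%:E).
    exact: measurable_cst.
  have mlnD' : measurable_fun [set: measurableTypeR R] (fun x => (lnD x)%:E).
    by apply/measurable_EFinP.
  have m1V' : measurable_fun [set: measurableTypeR R] (fun x => (\1_V x)%:E : \bar R).
    by apply/measurable_EFinP.
  rewrite (_ : (fun x => (w x)%:E) =
    fun x => (e%:E + (lnD x)%:E + t%:E * (\1_V x)%:E)%E); last first.
    by apply/funext => x; rewrite -EFinM -!EFinD.
  rewrite ge0_integralD//; last 4 first.
  - by move=> x _; rewrite -EFinD lee_fin u0.
  - exact: emeasurable_funD.
  - by move=> x _; rewrite -EFinM lee_fin mulr_ge0// ltW.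
  - exact: emeasurable_funM.
  rewrite ge0_integralD//; last 2 first.
  - by move=> x _; rewrite lee_fin ltW.
  - by move=> x _; rewrite lee_fin.
  rewrite ge0_integralZl//; last by rewrite lee_fin ltW.
  rewrite integral_cst// integral_indic// setIT.
  have /= -> := probability_setT mu; rewrite mule1.
  have -> : Lam + 2 * e = e + Lam + t * (e / t) by field; rewrite gt_eqF.
  rewrite !EFinD; apply: leeD; first exact: leeD.
  by rewrite [leRHS]EFinM lee_pmul2l// lte_fin.
pose theta' := (1 - theta)^-1 + theta^-1.
have theta'0 : 0 < theta'.
  by case/andP: theta01 => ? ?; rewrite addr_gt0// invr_gt0// subr_gt0.
pose q := (b - a) / eta + 1.
have q0 : 0 < q by rewrite ltr_wpDl// divr_ge0 ?(ltW eta_gt0)// subr_ge0 ltW.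
exists (e / s' / (2 * q * theta')).
  by apply: divr_gt0; [exact: divr_gt0|rewrite !mulr_gt0].
move=> n tau Htau.
have upper0 : upper_set (@set0 R) by [].
have tau0 : 0 <= tau by exact: le_trans (normr_ge0 _) (Htau _ upper0).
have [mE muE] := @typical_orbits _ mu F w (branches c d) _ s' n mesF invF mw w0
  intw s'0 (measurable_branches c d) muU.
set E := [set z | _] in mE muE.
pose kappa := 2 * tau * theta'.
have kappa0 : 0 <= kappa by rewrite !mulr_ge0// ltW.
have base Q : (forall W, is_interval W -> is_interval (Q `&` iter n F @^-1` W)) ->
    (mu Q <= kappa%:E)%E.
  move=> iQ; have := interval_mass (measurable_iter n mesF) uJ theta01 Htau iQ.
  by rewrite /kappa /theta' mulrDr.
have E_spec z : E z -> \sum_(j < n) u (iter j F z) <= s' * n%:R /\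
    N%:R ^+ (\sum_(j < n) (iter j F z \in V)) <= expR (e * n%:R) :> R.
  move=> [Sz _]; move: Sz; rewrite big_split/= -mulr_sumr.
  have -> : \sum_(j < n) \1_V (iter j F z) =
      (\sum_(j < n) (iter j F z \in V))%:R :> R.
    by rewrite natr_sum; apply: eq_bigr => j _; rewrite indicE.
  set v := (\sum_(j < n) _)%N => Sz; have v0 : 0 <= v%:R :> R by [].
  have Su : 0 <= \sum_(j < n) u (iter j F z) by exact: sumr_ge0.
  split; first by have := mulr_ge0 (ltW t0) v0; lra.
  have -> : N%:R ^+ v = expR (ln N%:R * v%:R) :> R.
    by rewrite expRM_natr lnK// posrE ltr0n.
  rewrite ler_expR.
  have /(ler_wpM2r (ltW e0)) : t * v%:R <= s' * n%:R by lra.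
  have -> : t * v%:R * e = s' * (ln N%:R * v%:R) + s' * v%:R.
    by rewrite /t; field; rewrite gt_eqF.
  by move=> tv; rewrite -(ler_pM2l s'0); have := mulr_ge0 (ltW s'0) v0; lra.
(* An interval of length l grows to at most eta along a typical orbit. *)
pose l := eta * expR (- (s' * n%:R)).
have l0 : 0 < l by rewrite mulr_gt0// expR_gt0.
have [p [A [pq iA Al Aab]]] := segment_cover (ltW ab) l0.
have AE k : (mu (A k `&` E) <= (expR (e * n%:R) * kappa)%:E)%E.
  apply: (@pieces_mass _ mu N (fun k => `]c k, d k[%classic) F u V eta kappa n
    _ _ _ u0 _ kappa0 base n 0%N (A k) E) => //.
  - by move=> i; exact: interval_is_interval.
  - move=> i x y z Bx By Bz xz yz; rewrite !(Ff i)// /u (lnDE i)//.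
    by apply: expand Bx By Bz _ _; exact: le_trans eta_le.
  - by move=> i z x; exact: boundary_layerP.
  - move=> W iW x y [Ax Wx] [Ay Wy] z xzy.
    by split; [exact: (iA k x y)|exact: (iW x y)].
  - move=> z Az Ez /=; have [Su Nv] := E_spec z Ez; split => //.
      by move=> j jn; have [_ /(_ j jn) [i _ Bi]] := Ez; exists i.
    move=> x x' Ax Ax'; apply: (@le_trans _ _ (l * expR (s' * n%:R))).
      by apply: ler_pM; rewrite ?expR_ge0 ?ler_expR//; exact: Al Ax Ax'.
    by rewrite /l -mulrA -expRD addNr expR0 mulr1.
have muEp : (mu E <= (p%:R * (expR (e * n%:R) * kappa))%:E)%E.
  have mA k : measurable (A k : set (measurableTypeR R)).
    exact: is_interval_measurable.
  have mAE k : measurable (A k `&` E : set (measurableTypeR R)).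
    exact: measurableI.
  have mUAE := measurable_bigcup_ord mAE.
  have mabC : measurable (~` `[a, b] : set (measurableTypeR R)).
    by apply: measurableC; exact: measurable_itv.
  apply: (@le_trans _ _ (mu (\bigcup_(k in [set: 'I_p]) (A k `&` E) `|` ~` `[a, b]))).
    apply: le_measure; rewrite ?inE//; first exact: measurableU.
    move=> z Ez; have [zab|zab] := pselect (`[a, b]%classic z); last by right.
    by left; have [k _ Akz] := Aab z zab; exists k.
  apply: le_trans (measureU2 _ _ _) _ => //.
  have muab0 : (mu (~` `[a, b]) <= 0)%E by rewrite muab.
  rewrite -[leRHS]adde0; apply: leeD; last exact: muab0.
  exact: measure_bigcup_ord_le.
have := le_trans muE muEp; rewrite lee_fin.
have -> : 1 - (Lam + 2 * e) / s' = e / s'.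
  by rewrite /s'; field; rewrite gt_eqF.
move=> es; rewrite ler_pdivrMr ?mulr_gt0//; apply: le_trans es _.
have pq' : p%:R <= q * expR (s' * n%:R).
  apply: le_trans pq _; rewrite /l /q expRN invfM invrK.
  rewrite [leRHS]mulrDl mul1r mulrA lerD2l -[leLHS]expR0 ler_expR.
  by rewrite mulr_ge0// ltW.
have -> : expR (s1 * n%:R) = expR (s' * n%:R) * expR (e * n%:R).
  by rewrite -expRD; congr expR; rewrite /s' /e; field.
rewrite /kappa; apply: le_trans (ler_wpM2r _ pq') _.
  by rewrite mulr_ge0// expR_ge0.
by rewrite le_eqVlt; apply/orP; left; apply/eqP; ring.
Qed.

(** * Null sets and a half-line of intermediate mass *)

Lemma finite_set_measurable (R : realType) (A : set R) :
  finite_set A -> measurable (A : set (measurableTypeR R)).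
Proof.
move=> /finite_set_countable cA; apply: countable_measurable cA => x.
exact: measurable_set1.
Qed.

Lemma dominated_countable0 (R : realType)
    (mu : probability (measurableTypeR R) R) (A : set R) :
  mu `<< lebesgue_measure -> countable A -> mu A = 0%E.
Proof.
move=> /null_content_dominatesP ac cA; apply: ac.
  by apply: countable_measurable cA => x; exact: measurable_set1.
exact: countable_lebesgue_measure0.
Qed.

Lemma measure_null_setC (R : realType)
    (mu : probability (measurableTypeR R) R) (D A : set R) :
  measurable (D : set (measurableTypeR R)) ->
  measurable (A : set (measurableTypeR R)) -> mu (~` D) = 0%E ->
  mu (D `&` A) = mu A.
Proof.
move=> mD mA D0; apply/eqP; rewrite eq_le; apply/andP; split.
  by apply: le_measure; rewrite ?inE//; exact: measurableI.
have mDC := measurableC mD.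
apply: (@le_trans _ _ (mu ((D `&` A) `|` ~` D))).
  apply: le_measure; rewrite ?inE//.
    by apply: measurableU => //; exact: measurableI.
  by move=> x Ax; have [Dx|Dx] := pselect (D x); [left|right].
apply: le_trans (measureU2 _ _ _) _ => //; first exact: measurableI.
have D0' : (mu (~` D) <= 0)%E by rewrite D0.
by rewrite -[leRHS]adde0; apply: leeD.
Qed.

(** Otherwise every half-line has mass 0 or 1, and all the mass sits at the
    point where the mass of the half-line to the right jumps. *)
Lemma nontrivial_upper_set (R : realType)
    (mu : probability (measurableTypeR R) R) (a b : R) :
  a < b -> mu `[a, b] = 1%E -> (forall x : R, mu [set x] = 0%E) ->
  exists J, upper_set J /\ 0 < fine (mu J) < 1.
Proof.
move=> ab muab atomless; apply: contrapT => nJ.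
pose ray (x : R) := [set y | x <= y].
have uray x : upper_set (ray x) by move=> y z /= xy yz; exact: le_trans yz.
have mr x : measurable (ray x : set (measurableTypeR R)).
  exact: upper_set_measurable.
have ray01 x : mu (ray x) = 0%E \/ mu (ray x) = 1%E.
  have [r0|r0] := pselect (mu (ray x) = 0%E); [by left|right].
  apply: contrapT => r1; apply: nJ; exists (ray x); split => //.
  have fr : mu (ray x) \is a fin_num by exact: fin_num_measure.
  rewrite -!lte_fin fineK// !lt_neqAle measure_ge0 probability_le1// !andbT.
  by apply/andP; split; apply/eqP => // /esym.
pose S := [set x | mu (ray x) = 1%E].
have Sa : S a.
  rewrite /S/=; have [r0|//] := ray01 a.
  have : (mu `[a, b] <= mu (ray a))%E.
    apply: le_measure; rewrite ?inE//.
    by move=> x /=; rewrite in_itv/= => /andP[].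
  by rewrite r0 muab lee_fin ler10.
have Sdown x y : S y -> x <= y -> S x.
  move=> Sy xy; rewrite /S/=; have [r0|//] := ray01 x.
  have : (mu (ray y) <= mu (ray x))%E.
    by apply: le_measure; rewrite ?inE//; move=> z; exact: le_trans xy.
  by rewrite Sy r0 lee_fin ler10.
have Sb x : S x -> x <= b.
  move=> Sx; rewrite leNgt; apply/negP => bx.
  have mab : measurable (`[a, b] : set (measurableTypeR R)).
    exact: measurable_itv.
  have : (mu (ray x) <= mu (~` `[a, b]))%E.
    apply: le_measure; rewrite ?inE//; first exact: measurableC.
    move=> y /= xy; rewrite in_itv/= => /andP[_ yb].
    by have := lt_le_trans bx (le_trans xy yb); rewrite ltxx.
  rewrite (probability_setC mu mab) muab Sx.
  by rewrite subee// lee_fin ler10.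
have supS : has_sup S by split; [exists a|exists b].
pose s := sup S.
pose above n := ray (s + n.+1%:R^-1); pose below n := ~` ray (s - n.+1%:R^-1).
have i0 n : 0 < n.+1%:R^-1 :> R by rewrite invr_gt0.
have above0 n : mu.-negligible (above n).
  apply/negligibleP; first exact: mr.
  have [r0|Sn] := ray01 (s + n.+1%:R^-1); first exact: r0.
  have := ub_le_sup supS.2 Sn; rewrite -/s.
  by rewrite gerDl leNgt i0.
have below0 n : mu.-negligible (below n).
  apply/negligibleP; first exact: measurableC.
  rewrite [LHS](probability_setC mu (mr _)); have [y Sy sy] := sup_adherent (i0 n) supS.
  by rewrite (Sdown _ y Sy (ltW sy)) subee.
have : mu.-negligible [set: R].
  apply: (@negligibleS _ _ _ mu
    (\bigcup_n above n `|` \bigcup_n below n `|` [set s])).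
    move=> x _; have [xs|xs|->] := ltgtP x s; last by right.
      left; right; have sx : 0 < s - x by rewrite subr_gt0.
      have [n _ nP] := near_infty_natSinv_lt (PosNum sx).
      exists n => //=; have := nP n (leqnn n); rewrite /= => nsx.
      by apply/negP; rewrite -ltNge ltrBrDr -ltrBrDl.
    left; left; have sx : 0 < x - s by rewrite subr_gt0.
    have [n _ nP] := near_infty_natSinv_lt (PosNum sx).
    by exists n => //=; have := nP n (leqnn n); rewrite /= => nsx;
      rewrite /above /ray /= -lerBrDl ltW.
  apply: negligibleU; first by apply: negligibleU; exact: negligible_bigcup.
  by apply/negligibleP; [exact: measurable_set1|exact: atomless].
move=> /negligibleP => /(_ measurableT).
by have /= -> := probability_setT mu => /eqP; rewrite eqe oner_eq0.
Qed.

Lemma Rintegral_null_setC (R : realType)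
    (mu : probability (measurableTypeR R) R) (D : set R) (h : R -> R) (M : R) :
  measurable (D : set (measurableTypeR R)) -> mu (~` D) = 0%E ->
  measurable_fun setT h -> (forall x, `|h x| <= M) ->
  \int[mu]_(x in D) h x = \int[mu]_x h x.
Proof.
move=> mD D0 mh hM; rewrite /Rintegral; congr fine.
have := @negligible_integral _ (measurableTypeR R) R mu setT (~` D) (EFin \o h)
  (measurableC mD) measurableT (bounded_integrable mu mh hM) D0.
by rewrite setTD setCK => ->.
Qed.

(** * Piecewise measurability and decay rates *)

(** The finitely many ends of the branches, where f and f' are arbitrary, do not
    affect measurability. *)
Lemma measurable_fun_branches (R : realType) (N : nat) (c d : 'I_N -> R)
    (D : set R) (g : R -> R) :
  branches c d `<=` D -> finite_set (D `\` branches c d) ->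
  (forall k, measurable_fun (`]c k, d k[ : set (measurableTypeR R)) g) ->
  measurable (D : set (measurableTypeR R)) /\
  measurable_fun (D : set (measurableTypeR R)) g.
Proof.
move=> UD fD mg; have -> : D = branches c d `|` (D `\` branches c d).
  by rewrite setDUK.
have mU := measurable_branches c d; have mDU := finite_set_measurable fD.
split; first exact: measurableU.
apply/measurable_funU => //; split.
  move=> _ Y mY; rewrite /branches setI_bigcupl.
  by apply: measurable_bigcup_ord => k; exact: (mg k (measurable_itv _)).
by move=> _ Y mY; apply: finite_set_measurable; exact: finite_setIl.
Qed.

Lemma limn_esup_ltey_bounded (R : realType) (u : nat -> R) :
  (limn_esup (fun n => `|u n|%:E) < +oo)%E ->
  exists M, forall n, `|u n| <= M.
Proof.
move=> /ereal_inf_lt[_ [V [n0 _ n0V] <-] Vy].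
have uV n : (n0 <= n)%N ->
    (`|u n|%:E <= ereal_sup [set `|u x|%:E | x in V])%E.
  by move=> n0n; apply: ereal_sup_ubound; exists n => //; exact: n0V.
pose r := fine (ereal_sup [set `|u x|%:E | x in V]).
have ur n : (n0 <= n)%N -> `|u n| <= r.
  move=> /uV un; rewrite -lee_fin /r fineK// ge0_fin_numE//.
  by apply: le_trans un; rewrite lee_fin.
exists (`|r| + \sum_(j < n0) `|u j|) => n.
have [nn0|/ur ur'] := ltnP n n0.
  rewrite (bigD1 (Ordinal nn0))//= addrCA lerDl addr_ge0//; exact: sumr_ge0.
by rewrite (le_trans ur')// (le_trans (ler_norm r))// lerDl sumr_ge0.
Qed.

(** A larger exponent s0 in the set would make exp(s0 n) C(n), and therefore the
    smaller exp(s n) C(n), bounded for all n. *)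
Lemma correlation_rate_le (R : realType) (a b : R) (f : R -> R)
    (mu : probability (measurableTypeR R) R) (phi psi : R -> R) (s : R) :
  (forall K, exists n, K < `|expR (s * n%:R) * correlation a b f mu phi psi n|) ->
  (correlation_rate a b f mu phi psi <= s%:E)%E.
Proof.
move=> unbounded; apply: ge_ereal_sup => _ [s0 s0P <-].
rewrite lee_fin leNgt; apply/negP => ss0.
have [M CM] := limn_esup_ltey_bounded s0P.
have [n] := unbounded M; rewrite ltNge => /negP; apply; apply: le_trans (CM n).
rewrite !normrM ler_wpM2r// !gtr0_norm ?expR_gt0// ler_expR.
by rewrite ler_wpM2r// ltW.
Qed.

Lemma ln_derive1_measurable (R : realType) (f : R -> R) (c d B : R) :
  (forall x y, `]c, d[%classic x -> `]c, d[%classic y ->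
    `|derive1 f x - derive1 f y| <= B * `|x - y|) ->
  measurable_fun (`]c, d[ : set (measurableTypeR R)) (fun x => ln `|derive1 f x|).
Proof.
move=> fL.
have mf' : measurable_fun (`]c, d[ : set (measurableTypeR R)) (derive1 f).
  apply: subspace_continuous_measurable_fun; first exact: measurable_itv.
  apply/subspace_continuousP => x Bx; apply/cvgrPdist_lt => e e0.
  rewrite near_withinE; near=> y => By.
  apply: le_lt_trans (fL x y Bx By) _.
  apply: (@le_lt_trans _ _ ((`|B| + 1) * `|x - y|)).
    by rewrite ler_wpM2r// (le_trans (ler_norm B))// lerDl.
  have B1 : 0 < `|B| + 1 by rewrite ltr_wpDl.
  rewrite -ltr_pdivlMl//; near: y.
  by apply: cvgr_dist_lt; [exact: cvg_id|rewrite mulr_gt0// invr_gt0].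
have mnorm : measurable_fun [set: R] (fun x : R => ln `|x|).
  exact: (measurableT_comp (@measurable_ln R) (@normr_measurable R setT)).
exact: (measurableT_comp mnorm mf').
Unshelve. all: by end_near. Qed.

Lemma branches_cover (R : realType) (N : nat) (c d : 'I_N -> R) (a b : R) :
  \bigcup_(k in [set: 'I_N]) `[c k, d k] = `[a, b] ->
  branches c d `<=` `[a, b] /\ finite_set (`[a, b] `\` branches c d).
Proof.
move=> cover; split.
  rewrite -cover => x [k _]; rewrite /= in_itv/= => /andP[/ltW cx /ltW xd].
  by exists k => //; rewrite /= in_itv/= cx.
apply: (@sub_finite_set _ _ (\bigcup_(k in [set: 'I_N]) [set c k; d k])).
  rewrite -cover => x [[k _]]; rewrite /= in_itv/= => /andP[cx xd] nU.
  exists k => //=; move: cx xd; rewrite !le_eqVlt.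
  move=> /predU1P[->|cx]; first by left.
  move=> /predU1P[->|xd]; first by right.
  by exfalso; apply: nU; exists k => //; rewrite /= in_itv/= cx.
by apply: bigcup_finite => // k _; exact: finite_set2.
Qed.

(** The infimum over the branches bounds |f'| from below only where f' is a genuine
    derivative, which is why everything is stated on open branches. *)
Lemma expanding_branches (R : realType) (N : nat) (c d : 'I_N -> R) (f : R -> R) :
  (forall k, c k < d k) ->
  (forall k, exists g : R -> R,
     (forall x, `]c k, d k[%classic x -> g x = f x) /\ smooth_on `[c k, d k] g) ->
  1 < inf [set `|derive1 f x| | x in branches c d] ->
  exists B, forall k x, `]c k, d k[%classic x ->
    [/\ derivable f x 1, 1 <= `|derive1 f x| &
      forall y, `]c k, d k[%classic y ->
        `|derive1 f x - derive1 f y| <= B * `|x - y|].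
Proof.
move=> cd smooth inf1.
have lip k : exists B, forall x, `]c k, d k[%classic x -> derivable f x 1 /\
    forall y, `]c k, d k[%classic y -> `|derive1 f x - derive1 f y| <= B * `|x - y|.
  by have [g [gf sg]] := smooth k; exact: smooth_on_lipschitz_derive1 (cd k) gf sg.
have [B BP] := choice lip.
exists (\sum_k `|B k|) => k x Bx; have [fx fL] := BP k x Bx; split => //.
  apply: le_trans (ltW inf1) _; apply: ge_inf; last by exists x => //; exists k.
  by exists 0 => _ [y _ <-].
move=> y /fL fxy; apply: le_trans fxy _; rewrite ler_wpM2r//.
rewrite (bigD1 k)//= (le_trans (ler_norm _))// lerDl.
exact: sumr_ge0.
Qed.

Lemma iter_patch (R : realType) (D : set R) (f : R -> R) (n : nat) x :
  set_fun D D f -> D x -> iter n (f \_ D) x = iter n f x /\ D (iter n f x).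
Proof.
move=> fD Dx; elim: n => [//|n [IH Dn]].
by rewrite !iterS IH patchE mem_set//; split => //; exact: fD.
Qed.

(** Outside the branches ln |f'| is a junk value, possibly negative; replacing it
    by 0 there makes the integrand nonnegative without changing the integral. *)
Lemma lyapunov_exponentE (R : realType) (mu : probability (measurableTypeR R) R)
    (a b : R) (N : nat) (c d : 'I_N -> R) (f : R -> R) :
  branches c d `<=` `[a, b] -> mu (~` branches c d) = 0%E ->
  measurable_fun (`[a, b] : set (measurableTypeR R)) (fun x => ln `|derive1 f x|) ->
  lyapunov_exponent a b f mu =
    (\int[mu]_x (((fun x => ln `|derive1 f x|) \_ (branches c d)) x)%:E)%E.
Proof.
move=> Uab muU mln; rewrite /lyapunov_exponent.
pose g x := ln `|derive1 f x|; pose h : R -> R := g \_ (branches c d).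
have mU := measurable_branches c d.
have mab : measurable (`[a, b] : set (measurableTypeR R)) by exact: measurable_itv.
have mh : measurable_fun (`[a, b] : set (measurableTypeR R)) h.
  by apply/measurable_restrict => //; apply: measurable_funS mln => //; exact: subIsetl.
transitivity (\int[mu]_(x in `[a, b]) (h x)%:E)%E.
  apply: (@ae_eq_integral _ (measurableTypeR R)) => //; do 2?exact/measurable_EFinP.
  exists (~` branches c d); split => //; first exact: measurableC.
  by move=> x /= nE Ux; apply: nE => _; rewrite /h patchE mem_set.
rewrite integral_mkcond; apply: eq_integral => x _; rewrite patchE.
case: ifPn => // /negP nab; rewrite /h patchE memNset// => Ux.
by apply: nab; rewrite inE; exact: Uab.
Qed.

(** Extending f by 0 outside the interval makes it a measurable map of the line
    and does not change the orbits that start in the interval. *)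
Lemma correlationE (R : realType) (mu : probability (measurableTypeR R) R)
    (a b : R) (f psi : R -> R) (J : set R) (M : R) (n : nat) :
  let F := f \_ `[a, b] in
  set_fun `[a, b] `[a, b] f -> mu (~` `[a, b]) = 0%E ->
  measurable_fun [set: measurableTypeR R] F -> upper_set J ->
  measurable_fun [set: R] psi -> (forall x, `|psi x| <= M) ->
  correlation a b f mu \1_J psi n =
    \int[mu]_x ((\1_J (iter n F x) - fine (mu J)) * psi x).
Proof.
move=> F fab muab mF uJ mpsi psiM.
have mab : measurable (`[a, b] : set (measurableTypeR R)) by exact: measurable_itv.
have mJ := upper_set_measurable uJ.
have m1J := measurable_indic_upper uJ.
have mJn : measurable_fun [set: R] (fun x => \1_J (iter n F x) : R).
  exact: (measurableT_comp m1J (measurable_iter n mF)).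
have mprod : measurable_fun [set: R] (fun x => \1_J (iter n F x) * psi x).
  exact: measurable_funM.
have prodM x : `|\1_J (iter n F x) * psi x| <= M.
  by rewrite normrM (le_trans (ler_piMl _ (normr_indic_le1 _ _)))// psiM.
have int1J : \int[mu]_(x in `[a, b]) \1_J x = fine (mu J).
  rewrite (Rintegral_null_setC mab muab m1J (normr_indic_le1 J)).
  by rewrite /Rintegral integral_indic// setIT.
have ipsi := bounded_integrable mu mpsi psiM.
rewrite /correlation int1J (Rintegral_null_setC mab muab mpsi psiM).
have -> : \int[mu]_(x in `[a, b]) (\1_J (iter n f x) * psi x) =
    \int[mu]_(x in `[a, b]) (\1_J (iter n F x) * psi x).
  apply: eq_Rintegral => x /set_mem abx.
  by have [-> _] := iter_patch n fab abx.
rewrite (Rintegral_null_setC mab muab mprod prodM) -RintegralZl//.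
rewrite -RintegralB//; first by apply: eq_Rintegral => x _; rewrite mulrBl.
  exact: bounded_integrable mprod prodM.
apply: (@bounded_integrable _ _ _ (`|fine (mu J)| * M)).
  by apply: measurable_funM => //; exact: measurable_cst.
by move=> x; rewrite normrM ler_wpM2l.
Qed.

Theorem proposition3p1 (R : realType) (a b : R) (f : R -> R)
    (mu : probability (measurableTypeR R) R) :
  a < b ->
  set_fun `[a, b] `[a, b] f ->
  piecewise_monotonic_smooth_expanding a b f ->
  unique_acip a b f mu ->
  mixing a b f mu ->
  (mixing_rate_BV a b f mu <= lyapunov_exponent a b f mu)%E.
Proof.
move=> ab fab [N [c [d [cd tI cover fk inf1]]]] [[muab ac inv] _] _.
have mab : measurable (`[a, b] : set (measurableTypeR R)) by exact: measurable_itv.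
have muabC : mu (~` `[a, b]) = 0%E.
  by rewrite (probability_setC mu mab) muab subee.
have [Uab finU] := branches_cover cover.
have [B fP] := expanding_branches cd (fun k => (fk k).2) inf1.
have muU : mu (~` branches c d) = 0%E.
  have mUC := measurableC (measurable_branches c d).
  rewrite -(measure_null_setC mab mUC muabC).
  by apply: dominated_countable0 ac _; exact: finite_set_countable.
pose F : R -> R := f \_ `[a, b].
have Ff k x : `]c k, d k[%classic x -> F x = f x.
  by move=> Bx; rewrite /F patchE mem_set//; apply: Uab; exists k.
have [_ mfab] : measurable (`[a, b] : set (measurableTypeR R)) /\
    measurable_fun (`[a, b] : set (measurableTypeR R)) f.
  apply: measurable_fun_branches Uab finU _ => k.
  apply: subspace_continuous_measurable_fun; first exact: measurable_itv.
  apply: derivable_within_continuous => x Bx.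
  by have [] := fP k x Bx.
have mF : measurable_fun [set: measurableTypeR R] F.
  exact/(measurable_restrictT f mab).
have invF A : measurable (A : set (measurableTypeR R)) -> mu (F @^-1` A) = mu A.
  move=> mA; rewrite -(inv A mA).
  rewrite -(measure_null_setC mab (measurable_preimage mF mA) muabC).
  congr (mu _); apply/seteqP; split => x /= [abx];
    by rewrite /F patchE (mem_set (abx : `[a, b]%classic x)).
have monoF k : strictly_monotone_on `]c k, d k[ F.
  by have [[mo|mo] _] := fk k; [left|right] => x y Bx By xy;
    rewrite (Ff k x)// (Ff k y)//; exact: mo.
have [_ mlnab] : measurable (`[a, b] : set (measurableTypeR R)) /\
    measurable_fun (`[a, b] : set (measurableTypeR R)) (fun x => ln `|derive1 f x|).
  apply: measurable_fun_branches Uab finU _ => k.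
  apply: (@ln_derive1_measurable _ f (c k) (d k) B) => x y Bx By.
  by have [_ _] := fP k x Bx; exact.
rewrite (lyapunov_exponentE Uab muU mlnab).
set lnD : R -> R := (fun x => ln `|derive1 f x|) \_ (branches c d).
have lnDE k x : `]c k, d k[%classic x -> lnD x = ln `|derive1 f x|.
  by move=> Bx; rewrite /lnD patchE mem_set//; exists k.
have lnD0 x : 0 <= lnD x.
  rewrite /lnD patchE; case: ifPn => // /set_mem[k _ Bx].
  by have [_ f1 _] := fP k x Bx; rewrite ln_ge0.
have mlnD : measurable_fun [set: measurableTypeR R] lnD.
  apply/(measurable_restrictT _ (measurable_branches c d)).
  by apply: measurable_funS mlnab.
have [[Lam LamE]|->] : (exists Lam, \int[mu]_x (lnD x)%:E = Lam%:E)%E \/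
    (\int[mu]_x (lnD x)%:E = +oo)%E; last by rewrite leey.
  have : (0 <= \int[mu]_x (lnD x)%:E)%E.
    by apply: integral_ge0 => x _; rewrite lee_fin.
  by case: (integral _ _ _) => [r _|_|//]; [left; exists r|right].
rewrite LamE; apply/lee_addgt0Pr => e e0; rewrite -EFinD.
have atomless (x : R) : mu [set x] = 0%E.
  by apply: dominated_countable0 ac _; exact: countable1.
have [J [uJ J01]] := nontrivial_upper_set ab muab atomless.
have Le : Lam < Lam + e / 2 by lra.
have intle : (\int[mu]_x (lnD x)%:E <= Lam%:E)%E by rewrite LamE.
have [C C0 Hosc] := orbit_estimate ab muabC tI muU monoF Ff fP mF invF mlnD lnD0
  lnDE intle Le uJ J01.
pose g n x := \1_J (iter n F x) - fine (mu J).
have mg n : measurable_fun [set: R] (g n).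
  apply: measurable_funB; last exact: measurable_cst.
  exact: (measurableT_comp (measurable_indic_upper uJ) (measurable_iter n mF)).
have g1 n x : `|g n x| <= 1.
  rewrite /g indicE ler_norml; move: J01 => /andP[? ?].
  by case: (_ \in _) => /=; apply/andP; split; lra.
have Le2 : Lam + e / 2 < Lam + e by lra.
have [psip [psim [np nm psi1 unbounded]]] := resonance mg g1 C0 Le2 Hosc.
pose psi x := psip x - psim x.
have psi3 x : `|psi x| <= 3.
  by apply: le_trans (ler_normB _ _) _; have [] := psi1 x; lra.
have mpsi : measurable_fun [set: R] psi.
  by apply: measurable_funB; exact: nondecreasing_measurable.
have BVJ : bounded_variation a b (\1_J : R -> R).
  apply: nondecreasing_bounded_variation => x y _ _.
  exact: upper_indic_nondecreasing.
have BVpsi : bounded_variation a b psi.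
  apply: (@bounded_variationD _ _ _ psip (\- psim)) => //.
    by apply: nondecreasing_bounded_variation => x y _ _; exact: np.
  apply: bounded_variationN.
  by apply: nondecreasing_bounded_variation => x y _ _; exact: nm.
apply: (@le_trans _ _ (correlation_rate a b f mu \1_J psi)).
  by apply: ereal_inf_lbound; exists \1_J => //; exists psi.
apply: correlation_rate_le => K; have [n Kn] := unbounded K.
by exists n; rewrite (correlationE n fab muabC mF uJ mpsi psi3).
Qed.
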